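(* Let $N$ be a non-negative, integer-valued random variable with $0<\mathbb{E}[N]$ and $\mathbb{E}[N^3]<\infty$. Let $X_1,X_2,\ldots$ be exchangeable non-negative, integer-valued random variables, independent of $N$, with $\mathbb{E}[X_1]>0$ and $\mathbb{E}[X_1^3]<\infty$, which satisfy the equally correlated model with parameter $\rho\in[0,1]$ (see context). Let $Y=X_1+\cdots+X_N$ and $Z\sim\mathrm{Po}(\mathbb{E}[N]\mathbb{E}[X_1])$. Then $$d_W(Y,Z)\leq3\rho\sqrt{\mathbb{E}[N]\mathbb{E}[X_1]}\left(\mathbb{E}|N+1-N^s|+\mathbb{E}[N]\,\mathbb{E}|X_1-1|+\frac{\mathbb{E}[N^2]}{\mathbb{E}[N]}\left[\frac{\mathbb{E}[X_1^2]}{\mathbb{E}[X_1]}-1\right]\right)$$ $$+3(1-\rho)\sqrt{\mathbb{E}[N]\mathbb{E}[X_1]}\left(\frac{\mathbb{E}[X_1^2]}{\mathbb{E}[X_1]}-1+\mathbb{E}\left|\sum_{k=1}^NX_k-\sum_{j=1}^{N^s-1}X_j'\right|\right)$$ for any coupling of $N^s$ and $N$, where $N^s$ is the size-biased version of $N$, the $X_j'$ ($j\ge1$) are IID copies of $X_1$ defined on the same probability space as the $X_k$, and the pair $(N,N^s)$ is independent of $\big((X_k)_{k\ge1},(X_j')_{j\ge1}\big)$.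
   Context: Equally correlated model with parameter $\rho\in[0,1]$: for all $n\in\{1,2,\ldots\}$ and all real $t_1,\ldots,t_n$, $$\mathbb{E}[e^{i(t_1X_1+\cdots+t_nX_n)}]=\rho\,\mathbb{E}[e^{iX_1(t_1+\cdots+t_n)}]+(1-\rho)\prod_{j=1}^n\mathbb{E}[e^{it_jX_j}].$$ Size-biased version: for a non-negative random variable $X$ with $\mathbb{E}[X]>0$, $X^s$ is a random variable whose law is determined by $\mathbb{E}g(X^s)=\mathbb{E}[Xg(X)]/\mathbb{E}[X]$ for all $g:\mathbb{R}^+\to\mathbb{R}$ for which this expectation exists; for $X$ supported on the non-negative integers, $\mathbb{P}(X^s=j)=j\,\mathbb{P}(X=j)/\mathbb{E}[X]$. Wasserstein distance: $d_W(U,V)=\sup_{h\in\mathcal{H}_W}|\mathbb{E}h(U)-\mathbb{E}h(V)|$, where $\mathcal{H}_W$ is the set of absolutely continuous $h:\mathbb{R}\to\mathbb{R}$ with $\|h'\|\le1$ and $\|\cdot\|$ is the supremum norm. $\mathrm{Po}(\mu)$ is the Poisson distribution with mean $\mu$. A coupling of two random variables is a construction of them on a common probability space with their given marginal laws. An empty sum is $0$. *)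

(* Defs.v *)
From HB Require Import structures.
From mathcomp Require Import all_boot all_order all_algebra perm.
From mathcomp Require Import complex.
From mathcomp Require Import all_classical all_reals all_analysis.

Set Implicit Arguments.
Unset Strict Implicit.
Unset Printing Implicit Defensive.

Import Order.TTheory GRing.Theory Num.Theory.
Import numFieldNormedType.Exports.

Local Open Scope classical_set_scope.
Local Open Scope ring_scope.

(* [fine] sends infinite values to 0, so this is to be
   used only where the expectation is finite. *)
Definition Emean d (T : measurableType d) (R : realType) (P : probability T R)
  (f : T -> R) : R := fine 'E_P[f]%E.

Definition Cmean d (T : measurableType d) (R : realType)
  (P : probability T R) (f : T -> R[i]) : R[i] :=
  (Emean P (fun w => complex.Re (f w)) +i* Emean P (fun w => complex.Im (f w)))%C.

(* [expi x] is e^{ix}. *)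
Definition expi (R : realType) (x : R) : R[i] := (cos x +i* sin x)%C.

Definition same_law d1 (T1 : measurableType d1) d2 (T2 : measurableType d2)
  d (U : measurableType d) (R : realType) (P1 : probability T1 R)
  (P2 : probability T2 R) (V : T1 -> U) (W : T2 -> U) : Prop :=
  forall A : set U, measurable A -> P1 (V @^-1` A) = P2 (W @^-1` A).

(* Equality of all finite-dimensional distributions, i.e. (by the pi-lambda
   theorem) of the laws of the sequences. *)
Definition same_law_seq d1 (T1 : measurableType d1) d2 (T2 : measurableType d2)
  d (U : measurableType d) (R : realType) (P1 : probability T1 R)
  (P2 : probability T2 R) (X : nat -> T1 -> U) (Y : nat -> T2 -> U) : Prop :=
  forall n : nat, same_law P1 P2
    (fun w => [tuple X i w | i < n]) (fun w => [tuple Y i w | i < n]).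

Definition exchangeable d (T : measurableType d) d' (U : measurableType d')
  (R : realType) (P : probability T R) (X : nat -> T -> U) : Prop :=
  forall (n : nat) (s : 'S_n), same_law P P
    (fun w => [tuple X (s i) w | i < n]) (fun w => [tuple X i w | i < n]).

(* X k stands for X_{k+1}. *)
Definition equally_correlated d (T : measurableType d) (R : realType)
  (P : probability T R) (rho : R) (X : nat -> T -> R) : Prop :=
  forall (n : nat) (t : 'I_n -> R), (0 < n)%N ->
    Cmean P (fun w => expi (\sum_(j < n) t j * X j w)) =
    rho%:C%C * Cmean P (fun w => expi (X 0%N w * \sum_(j < n) t j)) +
    (1 - rho)%:C%C * \prod_(j < n) Cmean P (fun w => expi (t j * X j w)).

Definition mutually_independent d (T : measurableType d)
  d' (U : measurableType d') (R : realType) (P : probability T R)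
  (X : nat -> T -> U) : Prop :=
  forall (s : seq nat) (A : nat -> set U), uniq s ->
    (forall j, measurable (A j)) ->
    P (\big[setI/setT]_(j <- s) (X j @^-1` A j)) =
    (\prod_(j <- s) P (X j @^-1` A j))%E.

Definition sigma_seq d (T : measurableType d) d' (U : measurableType d')
  (X : nat -> T -> U) : set (set T) :=
  <<s \bigcup_k preimage_set_system setT (X k) measurable >>.

Definition independent_of_seq d (T : measurableType d)
  d1 (U : measurableType d1) d2 (V : measurableType d2) (R : realType)
  (P : probability T R) (W : T -> U) (X : nat -> T -> V) : Prop :=
  forall (A : set U) (B : set T), measurable A -> sigma_seq X B ->
    P (W @^-1` A `&` B) = (P (W @^-1` A) * P B)%E.

(* Ws, possibly on another probability space, has the size-biased law of W. *)
Definition size_biased d (T : measurableType d) d' (T' : measurableType d')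
  (R : realType) (P : probability T R) (P' : probability T' R)
  (W : T -> R) (Ws : T' -> R) : Prop :=
  forall g : R -> R, measurable_fun setT g ->
    P.-integrable setT (fun w => (W w * g (W w))%:E) ->
    'E_P'[g \o Ws]%E = (Emean P (fun w => W w * g (W w)) / Emean P W)%:E.

Definition absolutely_continuous (R : realType) (h : R -> R) : Prop :=
  forall e : R, 0 < e -> exists2 delta : R, 0 < delta &
    forall (n : nat) (a b : 'I_n -> R),
      (forall i, a i <= b i) ->
      trivIset setT (fun i => `]a i, b i[%classic) ->
      \sum_(i < n) (b i - a i) < delta ->
      \sum_(i < n) `|h (b i) - h (a i)| < e.

(* The derivative of an absolutely continuous function exists almost everywhere,
   and its supremum norm is taken over the points where it exists. *)
Definition wasserstein_test (R : realType) (h : R -> R) : Prop :=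
  [/\ absolutely_continuous h,
      {ae @lebesgue_measure R, forall x, derivable h x 1} &
      forall x, derivable h x 1 -> `|h^`()%classic x| <= 1].

Definition dW d (T : measurableType d) d' (T' : measurableType d')
  (R : realType) (P : probability T R) (P' : probability T' R)
  (U : T -> R) (V : T' -> R) : \bar R :=
  ereal_sup [set `|'E_P[h \o U] - 'E_P'[h \o V]|%E | h in @wasserstein_test R].

(* Main.v *)
Require Import Defs.
From HB Require Import structures.
From mathcomp Require Import all_boot all_order all_algebra perm.
From mathcomp Require Import complex.
From mathcomp Require Import all_classical all_reals all_analysis.
From mathcomp Require Import measurable_realfun ring lra.

Set Implicit Arguments.
Unset Strict Implicit.
Unset Printing Implicit Defensive.

Import Order.TTheory GRing.Theory Num.Theory.
Import numFieldNormedType.Exports.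

Local Open Scope classical_set_scope.
Local Open Scope ring_scope.

(** Stein's method for the Poisson law of mean lam = E[N] E[X_1].  For a Lipschitz
    test function h, [poisson_stein] solves
    lam f(k + 1) - k f(k) = h(k) - E h(Z) by a function f whose increments are at
    most 2 / sqrt lam.  It then remains to bound lam E f(Y + 1) - E[Y f(Y)].

    Taking equal frequencies in the equally correlated model, and inverting
    characteristic functions of integer-valued variables ([charf_mixture]), the
    sum of n of the X_k has the law of n X_1 with weight rho and of the sum of n
    independent copies X'_j with weight 1 - rho.  As N is independent of the X_k,
    E[Y f(Y)] is therefore rho times the mean for N X_1 plus 1 - rho times the
    mean for the sum of N independent copies.  In the first case, replacing
    f(N X_1) by f(N) and size-biasing N gives lam E f(N^s); in the second,
    size-biasing N and a single summand gives lam E f(1 + X'_1 + ... + X'_{N^s - 1}).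
    The errors are of order E[X_1 |X_1 - 1|] = E[X_1^2] - E[X_1].

    The term f(Y + 1) is not split.  The same Y + 1 is compared with N^s in the
    first case, at cost E|N + 1 - N^s| + E|Y - N|, where
    E|Y - N| <= E[N] E|X_1 - 1| because Y has N summands, and with
    1 + X'_1 + ... + X'_{N^s - 1} in the second, at the cost of the coupling of the
    theorem.  This is why that coupling may involve the correlated X_k rather
    than independent ones ([random_sum_stein]).

    The test functions are absolutely continuous with slope at most 1 wherever
    they are derivable; [wasserstein_lipschitz] shows that they are 1-Lipschitz,
    through a covering of the null set of bad points. *)

(** * Means of real functions on a probability space *)

Definition L1 d (T : measurableType d) (R : realType) (P : probability T R)
  (F : T -> R) : Prop := P.-integrable setT (EFin \o F).

Section Mean.
Context d (T : measurableType d) (R : realType) (P : probability T R).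
Implicit Types (F G : T -> R) (U V : T -> nat).

Lemma EmeanE F : Emean P F = fine (\int[P]_w (F w)%:E)%E.
Proof. by rewrite /Emean unlock. Qed.

Lemma L1_measurable F : L1 P F -> measurable_fun setT F.
Proof. by move=> /measurable_int/measurable_EFinP. Qed.

Lemma expectation_L1 F : L1 P F -> 'E_P[F]%E = (Emean P F)%:E.
Proof.
move=> iF; rewrite EmeanE unlock fineK//.
by apply: integrable_fin_num => //; exact: measurableT.
Qed.

Lemma L1_le F G : measurable_fun setT F -> L1 P G ->
  (forall w, `|F w| <= G w) -> L1 P F.
Proof.
move=> mF iG FG; apply: (le_integrable _ _ _ iG) => //.
- exact/measurable_EFinP.
- by move=> w _ /=; rewrite lee_fin (le_trans (FG w))// ler_norm.
Qed.

Lemma L1_cst (c : R) : L1 P (fun=> c).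
Proof. exact: finite_measure_integrable_cst. Qed.

Lemma L1D F G : L1 P F -> L1 P G -> L1 P (fun w => F w + G w).
Proof. by move=> iF iG; exact: (integrableD measurableT iF iG). Qed.

Lemma L1B F G : L1 P F -> L1 P G -> L1 P (fun w => F w - G w).
Proof. by move=> iF iG; exact: (integrableB measurableT iF iG). Qed.

Lemma L1Z (c : R) F : L1 P F -> L1 P (fun w => c * F w).
Proof. by move=> iF; exact: (integrableZl measurableT c iF). Qed.

Lemma L1_norm F : L1 P F -> L1 P (fun w => `|F w|).
Proof. by move=> iF; apply: (integrable_norm iF). Qed.

Lemma L1_sum (I : Type) (s : seq I) (F : I -> T -> R) :
  (forall i, L1 P (F i)) -> L1 P (fun w => \sum_(i <- s) F i w).
Proof.
move=> iF; elim: s => [|i s IH].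
  under eq_fun do rewrite big_nil; exact: L1_cst.
under eq_fun do rewrite big_cons; exact: L1D.
Qed.

Lemma EmeanD F G : L1 P F -> L1 P G ->
  Emean P (fun w => F w + G w) = Emean P F + Emean P G.
Proof. by move=> iF iG; rewrite !EmeanE; exact: RintegralD. Qed.

Lemma EmeanB F G : L1 P F -> L1 P G ->
  Emean P (fun w => F w - G w) = Emean P F - Emean P G.
Proof. by move=> iF iG; rewrite !EmeanE; exact: RintegralB. Qed.

Lemma EmeanZ (c : R) F : L1 P F ->
  Emean P (fun w => c * F w) = c * Emean P F.
Proof. by move=> iF; rewrite !EmeanE; exact: RintegralZl. Qed.

Lemma Emean_cst (c : R) : Emean P (fun=> c) = c.
Proof. by rewrite /Emean expectation_cst. Qed.

Lemma Emean_sum (I : Type) (s : seq I) (F : I -> T -> R) :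
  (forall i, L1 P (F i)) ->
  Emean P (fun w => \sum_(i <- s) F i w) = \sum_(i <- s) Emean P (F i).
Proof.
move=> iF; elim: s => [|i s IH].
  by under eq_fun do rewrite big_nil; rewrite Emean_cst big_nil.
under eq_fun do rewrite big_cons.
by rewrite big_cons -IH EmeanD//; exact: L1_sum.
Qed.

Lemma Emean_ge0 F : (forall w, 0 <= F w) -> 0 <= Emean P F.
Proof. by move=> F0; rewrite fine_ge0// expectation_ge0. Qed.

Lemma Emean_le F G : L1 P F -> L1 P G -> (forall w, F w <= G w) ->
  Emean P F <= Emean P G.
Proof.
by move=> iF iG FG; rewrite !EmeanE; apply: le_Rintegral => // w _; exact: FG.
Qed.

Lemma Emean_norm_le F G : measurable_fun setT F -> L1 P G ->
  (forall w, `|F w| <= G w) -> `|Emean P F| <= Emean P G.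
Proof.
move=> mF iG FG; have iF := L1_le mF iG FG.
rewrite ler_norml -mulN1r -EmeanZ// !Emean_le//.
- by move=> w; apply: le_trans (FG w); rewrite ler_norm.
- exact: L1Z.
- by move=> w; have := FG w; rewrite ler_norml mulN1r => /andP[].
Qed.

Lemma Emean_dist_le F G H : L1 P F -> L1 P G -> L1 P H ->
  (forall w, `|F w - G w| <= H w) -> `|Emean P F - Emean P G| <= Emean P H.
Proof.
move=> iF iG iH FG; rewrite -EmeanB//; apply: Emean_norm_le => //.
by have /L1_measurable := L1B iF iG.
Qed.

Lemma L1_ge0 F : measurable_fun setT F -> (forall w, 0 <= F w) ->
  ('E_P[F] < +oo)%E -> L1 P F.
Proof.
move=> mF F0; rewrite unlock => EF; apply/integrableP; split.
  exact/measurable_EFinP.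
apply: le_lt_trans EF; rewrite le_eqVlt; apply/orP; left; apply/eqP.
by apply: eq_integral => w _ /=; rewrite ger0_norm.
Qed.

Lemma measurable_fun_nat U (phi : nat -> R) : measurable_fun setT U ->
  measurable_fun setT (fun w => phi (U w)).
Proof. by move=> mU; exact: (measurableT_comp (f := phi)). Qed.

Lemma L1_bounded F (c : R) : measurable_fun setT F -> (forall w, `|F w| <= c) ->
  L1 P F.
Proof. by move=> mF Fc; apply: (L1_le mF (L1_cst c)). Qed.

Lemma L1_bounded_mul F G (c : R) : measurable_fun setT F -> L1 P G ->
  (forall w, `|F w| <= c) -> L1 P (fun w => F w * G w).
Proof.
move=> mF iG Fc; apply: (L1_le (G := fun w => c * `|G w|)).
- by apply: measurable_funM => //; exact: L1_measurable.
- exact/L1Z/L1_norm.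
- by move=> w; rewrite normrM ler_wpM2r.
Qed.

Lemma L1_trunc F U n : L1 P F -> measurable_fun setT U ->
  L1 P (fun w => F w * (U w < n)%:R).
Proof.
move=> iF mU; under eq_fun do rewrite mulrC.
apply: (L1_bounded_mul (c := 1)) => //.
- exact: (measurable_fun_nat (fun k => (k < n)%:R)).
- by move=> w; case: (_ < _)%N; rewrite ?normr1 ?normr0.
Qed.

(** Truncating on the value of an integer-valued variable is how every mean
    below is reduced to finite sums over its values. *)
Lemma trunc_eventually (F : T -> R) U w :
  (fun n => F w * (U w < n)%:R) @ \oo --> F w.
Proof.
apply: cvg_near_cst; exists (U w).+1 => // n /= ltUn.
by rewrite ltUn mulr1.
Qed.

Lemma Emean_dominated_cvg (Fn : nat -> T -> R) F G :
  (forall n, measurable_fun setT (Fn n)) -> measurable_fun setT F -> L1 P G ->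
  (forall n w, `|Fn n w| <= G w) -> (forall w, Fn^~ w @ \oo --> F w) ->
  (fun n => Emean P (Fn n)) @ \oo --> Emean P F.
Proof.
move=> mFn mF iG FG FnF.
have := @dominated_convergence _ _ _ P setT measurableT
  (fun n w => (Fn n w)%:E) (EFin \o F) (EFin \o G).
case.
- by move=> n; exact/measurable_EFinP.
- exact/measurable_EFinP.
- by apply: aeW => w _; apply: cvg_EFin; [exact: nearW|exact: FnF].
- exact: iG.
- by apply: aeW => w n _; rewrite lee_fin.
move=> iF _ cv; under eq_fun do rewrite EmeanE.
rewrite EmeanE; apply: fine_cvg => /=.
by rewrite fineK//; apply: integrable_fin_num => //; exact: measurableT.
Qed.

Lemma Emean_trunc_cvg F U : L1 P F -> measurable_fun setT U ->
  (fun n => Emean P (fun w => F w * (U w < n)%:R)) @ \oo --> Emean P F.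
Proof.
move=> iF mU; apply: (Emean_dominated_cvg _ _ (L1_norm iF)).
- by move=> n; exact/L1_measurable/L1_trunc.
- exact/L1_measurable.
- move=> n w; rewrite normrM ler_piMr//.
  by case: (_ < _)%N; rewrite ?normr1 ?normr0.
- by move=> w; exact: trunc_eventually.
Qed.

(** Monotone convergence: the truncations increase to [F]. *)
Lemma L1_of_truncs F U (C : R) : measurable_fun setT F ->
  measurable_fun setT U -> (forall w, 0 <= F w) ->
  (forall n, L1 P (fun w => F w * (U w < n)%:R)) ->
  (forall n, Emean P (fun w => F w * (U w < n)%:R) <= C) -> L1 P F.
Proof.
move=> mF mU F0 iF FC; apply: L1_ge0 => //; rewrite unlock.
apply: (@le_lt_trans _ _ C%:E); last exact: ltry.
pose Fn n w := (F w * (U w < n)%:R)%:E.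
have mFn n : measurable_fun setT (Fn n).
  exact/measurable_EFinP/L1_measurable.
have Fn0 n w : setT w -> (0 <= Fn n w)%E by rewrite lee_fin mulr_ge0.
have ndFn w : setT w -> {homo Fn^~ w : m n / (m <= n)%N >-> (m <= n)%E}.
  move=> _ m n mn; rewrite lee_fin ler_wpM2l// ler_nat.
  by case: ltnP => // Um; rewrite (leq_trans Um mn).
rewrite (_ : (\int[P]_w (F w)%:E = \int[P]_w limn (Fn^~ w))%E); last first.
  apply: eq_integral => w _; apply/esym/cvg_lim => //.
  by apply: cvg_EFin; [exact: nearW|exact: trunc_eventually].
rewrite (monotone_convergence P measurableT mFn Fn0 ndFn).
apply: lime_le; last first.
  apply: nearW => n; have := FC n; rewrite -lee_fin -expectation_L1//.
  by rewrite unlock.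
apply: ereal_nondecreasing_is_cvgn => m n mn.
by apply: ge0_le_integral => // w _; [exact: Fn0|exact: ndFn].
Qed.

Definition mass U (k : nat) : R := Emean P (fun w => (U w == k)%:R).

Lemma L1_mass U k : measurable_fun setT U -> L1 P (fun w => (U w == k)%:R).
Proof.
move=> mU; apply: (L1_bounded (c := 1)).
- exact: (measurable_fun_nat (fun j => (j == k)%:R)).
- by move=> w; case: (_ == _); rewrite ?normr1 ?normr0.
Qed.

Lemma massE U k : measurable_fun setT U ->
  P (U @^-1` [set k]) = (mass U k)%:E.
Proof.
move=> mU; rewrite /mass -expectation_L1; last exact: L1_mass.
rewrite -(expectation_indic P); last first.
  by rewrite -[X in measurable X]setTI; exact: mU.
congr ('E_P[_])%E; apply/funext => w; rewrite indicE/=.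
by have [<-|/eqP Uk] := eqVneq (U w) k; [rewrite mem_set|rewrite memNset].
Qed.

Lemma mass_ge0 U k : 0 <= mass U k.
Proof. exact: Emean_ge0. Qed.

Lemma trunc_sum (phi : nat -> T -> R) U n w :
  phi (U w) w * (U w < n)%:R = \sum_(k < n) phi k w * (U w == k)%:R.
Proof.
have [Un|Un] := ltnP.
  rewrite (bigD1 (Ordinal Un))//= eqxx big1 ?addr0// => i /eqP neq.
  case: eqP => [Ui|]; last by rewrite mulr0.
  by case: neq; apply/val_inj.
rewrite mulr0 big1// => i _; case: eqP => [Ui|]; last by rewrite mulr0.
by have := ltn_ord i; rewrite -Ui ltnNge Un.
Qed.

Lemma L1_trunc_nat U (phi : nat -> R) n : measurable_fun setT U ->
  L1 P (fun w => phi (U w) * (U w < n)%:R).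
Proof.
move=> mU; under eq_fun do rewrite (trunc_sum (fun k _ => phi k)).
by apply: L1_sum => i; apply: L1Z; exact: L1_mass.
Qed.

Lemma Emean_trunc_nat U (phi : nat -> R) n : measurable_fun setT U ->
  Emean P (fun w => phi (U w) * (U w < n)%:R) = \sum_(k < n) phi k * mass U k.
Proof.
move=> mU; under eq_fun do rewrite (trunc_sum (fun k _ => phi k)).
rewrite Emean_sum; last by move=> i; apply: L1Z; exact: L1_mass.
by apply: eq_bigr => i _; rewrite EmeanZ//; exact: L1_mass.
Qed.

Lemma Emean_series U (phi : nat -> R) : measurable_fun setT U ->
  L1 P (fun w => phi (U w)) ->
  (fun n => \sum_(k < n) phi k * mass U k) @ \oo -->
    Emean P (fun w => phi (U w)).
Proof.
move=> mU iphi; under eq_fun do rewrite -Emean_trunc_nat//.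
exact: Emean_trunc_cvg.
Qed.

End Mean.
Arguments L1_bounded {d T R P F c}.

(** * Transfer between integer-valued variables *)

(** Two integer-valued variables whose laws agree up to the weights [a] and
    [b].  With constant weights this is transfer between equally distributed
    variables; with the weight [k] on one side and a constant on the other it
    covers size-biasing and the identity E[Z g(Z)] = lam E[g(Z + 1)]
    characterising the Poisson law of mean lam. *)
Section WeightedTransfer.
Context d1 (T1 : measurableType d1) d2 (T2 : measurableType d2) (R : realType).
Context (P1 : probability T1 R) (P2 : probability T2 R).
Context (U : T1 -> nat) (V : T2 -> nat) (a b : nat -> R).
Hypothesis mU : measurable_fun setT U.
Hypothesis mV : measurable_fun setT V.
Hypothesis a0 : forall k, 0 <= a k.
Hypothesis b0 : forall k, 0 <= b k.
Hypothesis ab : forall k, a k * mass P1 U k = b k * mass P2 V k.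

Lemma L1_weighted phi : L1 P1 (fun w => a (U w) * phi (U w)) ->
  L1 P2 (fun w => b (V w) * phi (V w)).
Proof.
move=> iphi.
suff /L1_le : L1 P2 (fun w => b (V w) * `|phi (V w)|).
  apply; first exact: (measurable_fun_nat (fun k => b k * phi k)).
  by move=> w; rewrite normrM ger0_norm.
apply: (L1_of_truncs (U := V)
  (C := Emean P1 (fun w => `|a (U w) * phi (U w)|))) => //.
- exact: (measurable_fun_nat (fun k => b k * `|phi k|)).
- by move=> w; rewrite mulr_ge0.
- by move=> n; exact: (L1_trunc_nat P2 (fun k => b k * `|phi k|)).
move=> n; rewrite (Emean_trunc_nat P2 (fun k => b k * `|phi k|))//.
under eq_bigr do rewrite mulrAC -ab mulrAC.
rewrite -(Emean_trunc_nat P1 (fun k => a k * `|phi k|))//.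
apply: Emean_le.
- exact: (L1_trunc_nat P1 (fun k => a k * `|phi k|)).
- exact: L1_norm.
- move=> w; rewrite normrM (ger0_norm (a0 _)) ler_piMr ?mulr_ge0//.
  by case: (_ < _)%N.
Qed.

Lemma Emean_weighted phi : L1 P1 (fun w => a (U w) * phi (U w)) ->
  Emean P1 (fun w => a (U w) * phi (U w)) =
  Emean P2 (fun w => b (V w) * phi (V w)).
Proof.
move=> iphi; have iphi2 := L1_weighted iphi.
have c1 := Emean_series (phi := fun k => a k * phi k) mU iphi.
have := Emean_series (phi := fun k => b k * phi k) mV iphi2.
under eq_fun do under eq_bigr do rewrite mulrAC -ab mulrAC.
by move=> c2; exact: (cvg_unique _ c1 c2).
Qed.

End WeightedTransfer.

Section SameMass.
Context d1 (T1 : measurableType d1) d2 (T2 : measurableType d2) (R : realType).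
Context (P1 : probability T1 R) (P2 : probability T2 R).
Context (U : T1 -> nat) (V : T2 -> nat).
Hypothesis mU : measurable_fun setT U.
Hypothesis mV : measurable_fun setT V.
Hypothesis UV : mass P1 U =1 mass P2 V.

Lemma L1_mass_eq (phi : nat -> R) :
  L1 P1 (fun w => phi (U w)) -> L1 P2 (fun w => phi (V w)).
Proof.
move=> iphi.
suff: L1 P2 (fun w => 1 * phi (V w)) by under eq_fun do rewrite mul1r.
apply: (L1_weighted (P1 := P1) (U := U) (a := fun=> 1) (b := fun=> 1)) => //.
  by move=> k; rewrite UV.
by under eq_fun do rewrite mul1r.
Qed.

Lemma Emean_mass_eq (phi : nat -> R) : L1 P1 (fun w => phi (U w)) ->
  Emean P1 (fun w => phi (U w)) = Emean P2 (fun w => phi (V w)).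
Proof.
move=> iphi; have iphi2 := L1_mass_eq iphi.
have c1 := Emean_series mU iphi; have := Emean_series mV iphi2.
under eq_fun do under eq_bigr do rewrite -UV.
by move=> c2; exact: (cvg_unique _ c1 c2).
Qed.

End SameMass.

(** * Independence of integer-valued variables *)

Lemma measurable_at d (T : measurableType d) d' (S : measurableType d')
    (U : T -> nat) (h : nat -> T -> S) : measurable_fun setT U ->
  (forall n, measurable_fun setT (h n)) ->
  measurable_fun setT (fun w => h (U w) w).
Proof.
move=> mU mh _ B mB; rewrite setTI.
rewrite (_ : _ @^-1` _ = \bigcup_n ((U @^-1` [set n]) `&` (h n @^-1` B))).
  apply: bigcup_measurable => n _; apply: measurableI.
    by rewrite -[X in measurable X]setTI; exact: mU.
  by rewrite -[X in measurable X]setTI; exact: mh.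
apply/seteqP; split => [w Bw|w [n _ [/= -> //]]].
by exists (U w).
Qed.

Section Independence.
Context d (T : measurableType d) (R : realType) (P : probability T R).
Implicit Types U V : T -> nat.

Definition indep U V : Prop := forall i k,
  Emean P (fun w => (U w == i)%:R * (V w == k)%:R) = mass P U i * mass P V k.

(** Both sides are limits of the truncations [V < n], for which the identity is
    a finite sum of instances of [indep]. *)
Lemma Emean_indep_event U V i (g : nat -> R) :
  measurable_fun setT U -> measurable_fun setT V -> indep U V ->
  L1 P (fun w => g (V w)) ->
  Emean P (fun w => (U w == i)%:R * g (V w)) =
    mass P U i * Emean P (fun w => g (V w)).
Proof.
move=> mU mV UV ig.
have mI : measurable_fun setT (fun w => (U w == i)%:R : R).
  exact: (measurable_fun_nat (fun j => (j == i)%:R)).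
have bI w : `|(U w == i)%:R : R| <= 1.
  by case: (_ == _); rewrite ?normr1 ?normr0.
have c1 := Emean_trunc_cvg (L1_bounded_mul mI ig bI) mV.
have c2 : (fun n => mass P U i * \sum_(k < n) g k * mass P V k) @ \oo -->
    mass P U i * Emean P (fun w => g (V w)).
  by apply: cvgM; [exact: cvg_cst|exact: Emean_series].
suff E : (fun n => Emean P (fun w => (U w == i)%:R * g (V w) * (V w < n)%:R)) =
         (fun n => mass P U i * \sum_(k < n) g k * mass P V k).
  by rewrite E in c1; exact: (cvg_unique _ c1 c2).
apply/funext => n.
under eq_fun do rewrite -mulrA (trunc_sum (fun k _ => g k)) mulr_sumr.
have iI k : L1 P (fun w => (U w == i)%:R * (V w == k)%:R).
  by apply: (L1_bounded_mul (c := 1)) => //; exact: L1_mass.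
rewrite Emean_sum; last first.
  by move=> k; under eq_fun do rewrite mulrCA; exact: L1Z.
rewrite mulr_sumr; apply: eq_bigr => k _.
under eq_fun do rewrite mulrCA.
by rewrite EmeanZ// UV mulrCA.
Qed.

(** Conditioning on [U]: since each [V n] is independent of [U], the mean of
    [g U (V U)] may be computed by first freezing the value of [U].  The bound
    [A] is what makes the outer integral converge. *)
Section Freezing.
Context (U : T -> nat) (V : nat -> T -> nat) (g : nat -> nat -> R)
  (A : nat -> R).
Hypothesis mU : measurable_fun setT U.
Hypothesis mV : forall n, measurable_fun setT (V n).
Hypothesis UV : forall n, indep U (V n).
Hypothesis ig : forall n, L1 P (fun w => g n (V n w)).
Hypothesis gA : forall n, Emean P (fun w => `|g n (V n w)|) <= A n.
Hypothesis iA : L1 P (fun w => A (U w)).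

Let trunc (h : nat -> nat -> R) : (forall n, L1 P (fun w => h n (V n w))) ->
  forall n, L1 P (fun w => h (U w) (V (U w) w) * (U w < n)%:R) /\
  Emean P (fun w => h (U w) (V (U w) w) * (U w < n)%:R) =
  \sum_(k < n) Emean P (fun w => h k (V k w)) * mass P U k.
Proof.
move=> ih n; under eq_fun do rewrite (trunc_sum (fun k w => h k (V k w))).
have iI k : L1 P (fun w => h k (V k w) * (U w == k)%:R).
  under eq_fun do rewrite mulrC.
  apply: (L1_bounded_mul (c := 1)) => //.
    exact: (measurable_fun_nat (fun j => (j == k)%:R)).
  by move=> w; case: (_ == _); rewrite ?normr1 ?normr0.
split; first exact: L1_sum.
rewrite Emean_sum//; apply: eq_bigr => k _; rewrite mulrC.
by under eq_fun do rewrite mulrC; rewrite Emean_indep_event.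
Qed.

Lemma L1_freeze : L1 P (fun w => g (U w) (V (U w) w)).
Proof.
have mg : measurable_fun setT (fun w => g (U w) (V (U w) w)).
  apply: (measurable_at (h := fun n w => g n (V n w))) => // n.
  exact: measurable_fun_nat.
suff /L1_le : L1 P (fun w => `|g (U w) (V (U w) w)|) by apply.
have ign n : L1 P (fun w => `|g n (V n w)|) by exact: L1_norm.
have tr := trunc (h := fun n k => `|g n k|) ign.
apply: (L1_of_truncs (U := U) (C := Emean P (fun w => A (U w)))) => //.
- exact: measurableT_comp.
- by move=> n; exact: (tr n).1.
move=> n; rewrite (tr n).2.
have A0 k : 0 <= A k by apply: le_trans (gA k); exact: Emean_ge0.
apply: (@le_trans _ _ (\sum_(k < n) A k * mass P U k)).
  by apply: ler_sum => k _; rewrite ler_wpM2r// mass_ge0.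
rewrite -Emean_trunc_nat//; apply: Emean_le => //; first exact: L1_trunc_nat.
by move=> w; rewrite ler_piMr//; case: (_ < _)%N.
Qed.

Lemma L1_freeze_mean :
  L1 P (fun w => Emean P (fun w' => g (U w) (V (U w) w'))).
Proof.
apply: (L1_le _ iA).
- exact: (measurable_fun_nat (fun n => Emean P (fun w' => g n (V n w')))).
- move=> w; apply: le_trans (gA _); apply: Emean_norm_le => //.
  + exact/measurable_fun_nat.
  + exact: L1_norm.
Qed.

Lemma Emean_freeze : Emean P (fun w => g (U w) (V (U w) w)) =
  Emean P (fun w => Emean P (fun w' => g (U w) (V (U w) w'))).
Proof.
have c1 := Emean_trunc_cvg L1_freeze mU.
have := Emean_series (phi := fun n => Emean P (fun w' => g n (V n w'))) mU
  L1_freeze_mean.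
under eq_fun do rewrite -(trunc ig _).2.
by move=> c2; exact: (cvg_unique _ c1 c2).
Qed.

End Freezing.

Section Product.
Context (U V : T -> nat) (f g : nat -> R).
Hypothesis mU : measurable_fun setT U.
Hypothesis mV : measurable_fun setT V.
Hypothesis UV : indep U V.
Hypothesis iF : L1 P (fun w => f (U w)).
Hypothesis iG : L1 P (fun w => g (V w)).

Let igz n : L1 P (fun w => f n * g (V w)).
Proof. exact: L1Z. Qed.

Let bnd n : Emean P (fun w => `|f n * g (V w)|) <=
  Emean P (fun w => `|g (V w)|) * `|f n|.
Proof.
under eq_fun do rewrite normrM.
rewrite EmeanZ; last exact: L1_norm.
by rewrite [leLHS]mulrC.
Qed.

Let iA : L1 P (fun w => Emean P (fun w => `|g (V w)|) * `|f (U w)|).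
Proof. exact/L1Z/L1_norm. Qed.

Lemma L1_indepM : L1 P (fun w => f (U w) * g (V w)).
Proof.
exact: (L1_freeze (V := fun=> V) (g := fun i k => f i * g k) mU (fun=> mV)
  (fun=> UV) igz bnd iA).
Qed.

Lemma Emean_indepM : Emean P (fun w => f (U w) * g (V w)) =
  Emean P (fun w => f (U w)) * Emean P (fun w => g (V w)).
Proof.
rewrite (Emean_freeze (V := fun=> V) (g := fun i k => f i * g k) mU (fun=> mV)
  (fun=> UV) igz bnd iA).
under eq_fun do rewrite EmeanZ// [_ * Emean _ _]mulrC.
by rewrite EmeanZ// [LHS]mulrC.
Qed.

End Product.
End Independence.

(** * The Stein equation of the Poisson law *)

(** The Poisson law enters only through the recurrence [massS] between
    consecutive masses. *)
Section PoissonStein.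
Context d (T : measurableType d) (R : realType) (P : probability T R).
Context (Z : T -> nat) (lam : R).
Hypothesis mZ : measurable_fun setT Z.
Hypothesis lam0 : 0 < lam.
Hypothesis mass_gt0 : forall k, 0 < mass P Z k.
Hypothesis massS : forall k, k.+1%:R * mass P Z k.+1 = lam * mass P Z k.

Let E (g : nat -> R) := Emean P (fun w => g (Z w)).
Let I (g : nat -> R) := L1 P (fun w => g (Z w)).

Let ED g1 g2 : I g1 -> I g2 -> E (fun z => g1 z + g2 z) = E g1 + E g2.
Proof. exact: EmeanD. Qed.
Let EB g1 g2 : I g1 -> I g2 -> E (fun z => g1 z - g2 z) = E g1 - E g2.
Proof. exact: EmeanB. Qed.
Let EZ c g : I g -> E (fun z => c * g z) = c * E g.
Proof. exact: EmeanZ. Qed.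
Let ID g1 g2 : I g1 -> I g2 -> I (fun z => g1 z + g2 z).
Proof. exact: L1D. Qed.
Let IB g1 g2 : I g1 -> I g2 -> I (fun z => g1 z - g2 z).
Proof. exact: L1B. Qed.
Let IZ c g : I g -> I (fun z => c * g z).
Proof. exact: L1Z. Qed.
Let Ile g1 g2 : I g2 -> (forall z, `|g1 z| <= g2 z) -> I g1.
Proof.
by move=> i2 g12; apply: (L1_le _ i2) => // ; exact: measurable_fun_nat.
Qed.
Let Icst c : I (fun=> c). Proof. exact: L1_cst. Qed.
Let Ecst c : E (fun=> c) = c. Proof. exact: Emean_cst. Qed.
Let Ibool (b : nat -> bool) : I (fun z => (b z)%:R).
Proof.
by apply: (Ile (Icst 1)) => z; case: (b z); rewrite ?normr1 ?normr0.
Qed.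
Let IMbool (b : nat -> bool) g : I g -> I (fun z => g z * (b z)%:R).
Proof.
move=> ig; apply: (Ile (g2 := fun z => `|g z|)); first exact: L1_norm.
by move=> z; case: (b z); rewrite ?mulr1// mulr0 normr0.
Qed.

Let shift_mass k : lam * mass P (fun w => (Z w).+1) k = k%:R * mass P Z k.
Proof.
case: k => [|k]; last by rewrite massS.
rewrite mul0r /mass (_ : (fun w => _) = fun=> 0) ?Emean_cst ?mulr0//.
Qed.

Let mZS : measurable_fun setT (fun w => (Z w).+1).
Proof. exact: (measurableT_comp (f := succn)). Qed.

Let I_stein g : I (fun z => g z.+1) -> I (fun z => z%:R * g z).
Proof.
move=> ig; apply: (L1_weighted (P1 := P) (U := fun w => (Z w).+1)
  (a := fun=> lam) (b := fun k => k%:R)) => //; first by move=> _; exact: ltW.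
exact: L1Z.
Qed.

Lemma poisson_identity g : I (fun z => g z.+1) ->
  E (fun z => z%:R * g z) = lam * E (fun z => g z.+1).
Proof.
move=> ig; rewrite -EZ//; apply/esym.
apply: (Emean_weighted (P1 := P) (U := fun w => (Z w).+1)
  (a := fun=> lam) (b := fun k => k%:R)) => //; first by move=> _; exact: ltW.
exact: L1Z.
Qed.

Let IN : I (fun z => z%:R).
Proof.
have := I_stein (g := fun=> 1) (Icst 1).
by rewrite /I; under eq_fun do rewrite mulr1.
Qed.

Let EN : E (fun z => z%:R) = lam.
Proof.
have := poisson_identity (g := fun=> 1) (Icst 1).
by rewrite Ecst mulr1 => <-; rewrite /E; under [in RHS]eq_fun do rewrite mulr1.
Qed.

Let ISN : I (fun z => z.+1%:R).
Proof.
by have := ID IN (Icst 1); rewrite /I; under eq_fun do rewrite natr1.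
Qed.

Let IN2 : I (fun z => z%:R * z%:R).
Proof. exact: (I_stein (g := fun z => z%:R) ISN). Qed.

Let EN2 : E (fun z => z%:R * z%:R) = lam * (lam + 1).
Proof.
rewrite (poisson_identity (g := fun z => z%:R) ISN); congr (_ * _).
rewrite -[X in X + _]EN -[X in _ + X](Ecst 1) -ED//.
by rewrite /E; under [in RHS]eq_fun do rewrite natr1.
Qed.

Section Level.
Context (k : nat).
Local Notation x := (lam - k%:R).
Local Notation m := (E (fun z => (k - z)%:R)).
Local Notation p := (E (fun z => (z - k)%:R)).
Local Notation F := (E (fun z => (z < k)%N%:R)).
Local Notation q := (k%:R * mass P Z k).

Lemma L1_lower_tail : I (fun z => (k - z)%:R).
Proof.
by apply: (Ile (Icst k%:R)) => z; rewrite ger0_norm// ler_nat leq_subr.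
Qed.

Lemma L1_upper_tail : I (fun z => (z - k)%:R).
Proof. by apply: (Ile IN) => z; rewrite ger0_norm// ler_nat leq_subr. Qed.

Let Im : I (fun z => (k - z)%:R) := L1_lower_tail.
Let Ip : I (fun z => (z - k)%:R) := L1_upper_tail.
Let IF : I (fun z => (z < k)%N%:R). Proof. exact: Ibool. Qed.

Let m0 : 0 <= m. Proof. exact: Emean_ge0. Qed.
Let p0 : 0 <= p. Proof. exact: Emean_ge0. Qed.

Lemma poisson_tails_diff : p = m + x.
Proof.
apply/eqP; rewrite -subr_eq0 opprD addrA subr_eq0 -EB//.
rewrite -[X in _ == X - _]EN -[X in _ == _ - X](Ecst k%:R) -EB//.
apply/eqP; congr Emean; apply/funext => w; move: (Z w) => z.
by have [kz|zk] := leqP k z;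
  [rewrite (eqP kz) subr0 natrB|rewrite (eqP (ltnW zk)) natrB 1?ltnW//; ring].
Qed.

Lemma poisson_lower_tailE : m = q - x * F.
Proof.
have Ile' : I (fun z => (z <= k)%N%:R) by exact: Ibool.
have E1 : E (fun z => (z <= k)%N%:R) = F + mass P Z k.
  rewrite -[mass P Z k]/(E (fun z => (z == k)%:R)).
  rewrite -ED; [|exact: IF|exact: (Ibool (fun z => z == k))].
  congr Emean; apply/funext => w; rewrite -natrD leq_eqVlt.
  by case: ltngtP.
have E2 := poisson_identity (g := fun z => (z <= k)%N%:R) IF.
have : m = k%:R * E (fun z => (z <= k)%N%:R)
   - E (fun z => z%:R * (z <= k)%N%:R).
  rewrite -EZ// -EB//; [|exact: IZ|exact: I_stein].
  congr Emean; apply/funext => w; move: (Z w) => z.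
  have [zk|kz] := leqP z k; first by rewrite !mulr1 natrB.
  by rewrite (eqP (ltnW kz)) !mulr0 subr0.
by rewrite E1 E2 => ->; ring.
Qed.

(* The identity applied to [(k - z)^+], whose decrement is [z < k]: when [k] is
   below the mean, [lam - z >= lam - k] wherever [(k - z)^+] is nonzero. *)
Let below : 0 <= x -> x * m <= lam * F.
Proof.
move=> x0.
have Ig : I (fun z => (k - z.+1)%:R).
  by apply: (Ile (Icst k%:R)) => z; rewrite ger0_norm// ler_nat leq_subr.
have E1 := poisson_identity (g := fun z => (k - z)%:R) Ig.
have -> : lam * F = lam * m - E (fun z => z%:R * (k - z)%:R).
  rewrite E1 -mulrBr -EB//; congr (_ * Emean _ _); apply/funext => w.
  move: (Z w) => z; have [zk|kz] := ltnP z k.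
    by rewrite -(subnSK zk) -natr1 addrAC subrr add0r.
  by rewrite (eqP kz) (eqP (leqW kz)) subr0.
have Iz : I (fun z => z%:R * (k - z)%:R) by exact: I_stein.
rewrite -!EZ// -EB//; last exact: IZ.
apply: Emean_le; [exact: (IZ _ L1_lower_tail)|exact: (IB (IZ _ L1_lower_tail) Iz)|].
move=> w; move: (Z w) => z; rewrite -mulrBl.
have [zk|kz] := leqP z k; last by rewrite (eqP (ltnW kz)) !mulr0.
by rewrite ler_wpM2r// lerB// ler_nat.
Qed.

(* Mirror image of the previous bound, with [(z - k)^+]. *)
Let above : x <= 0 -> - x * p <= lam * (1 - F).
Proof.
move=> x0.
have Ig : I (fun z => (z.+1 - k)%:R).
  by apply: (Ile ISN) => z; rewrite ger0_norm// ler_nat leq_subr.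
have E1 := poisson_identity (g := fun z => (z - k)%:R) Ig.
have -> : lam * (1 - F) = E (fun z => z%:R * (z - k)%:R) - lam * p.
  rewrite E1 -mulrBr -EB//; congr (_ * _).
  rewrite -[X in X - _](Ecst 1) -EB//; congr Emean; apply/funext => w.
  move: (Z w) => z; have [zk|kz] := ltnP z k.
    by rewrite (eqP zk) (eqP (ltnW zk)) !subrr.
  by rewrite subSn// -natr1 subr0 addrAC subrr add0r.
have Iz : I (fun z => z%:R * (z - k)%:R) by exact: I_stein.
rewrite -!EZ// -EB//; last exact: IZ.
apply: Emean_le; [exact: (IZ _ L1_upper_tail)|exact: (IB Iz (IZ _ L1_upper_tail))|].
move=> w; move: (Z w) => z; rewrite -mulrBl opprB.
have [zk|kz] := leqP k z; last by rewrite (eqP (ltnW kz)) !mulr0.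
by rewrite ler_wpM2r// lerB// ler_nat.
Qed.

(* [s ^ 2] is the second moment of [Z - k], so [s] dominates both tails. *)
Let s := Num.sqrt (lam + x ^+ 2).
Let s0 : 0 < s. Proof. by rewrite sqrtr_gt0 ltr_wpDr// sqr_ge0. Qed.
Let s2 : s ^+ 2 = lam + x ^+ 2.
Proof. by rewrite sqr_sqrtr// addr_ge0 ?sqr_ge0// ltW. Qed.

Let ms_ps : m <= s /\ p <= s.
Proof.
have Isq : I (fun z => z%:R * z%:R - 2 * k%:R * z%:R + k%:R ^+ 2).
  by apply: ID => //; apply: IB => //; exact: IZ.
have Esq : E (fun z => z%:R * z%:R - 2 * k%:R * z%:R + k%:R ^+ 2) = s ^+ 2.
  rewrite ED//; last by apply: IB => //; exact: IZ.
  rewrite EB//; last exact: IZ.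
  by rewrite EZ// Ecst EN EN2 s2; ring.
have AMGM g : I g -> (forall z, g z ^+ 2 <= (z%:R - k%:R) ^+ 2) -> E g <= s.
  move=> Ig gz; rewrite -(ler_pM2l s0) -(ler_pM2l (ltr0n R 2)).
  have -> : 2 * (s * s) = E (fun z => z%:R * z%:R - 2 * k%:R * z%:R + k%:R ^+ 2
    + s ^+ 2) by rewrite ED// Esq Ecst; ring.
  rewrite mulrA -EZ//; apply: Emean_le; [exact: (IZ _ Ig)|exact: (ID Isq (Icst _))|].
  move=> w; have := gz (Z w); have := sqr_ge0 (g (Z w) - s); lra.
split; apply: AMGM => // z.
- have [zk|kz] := leqP z k; first by rewrite natrB//; lra.
  by rewrite (eqP (ltnW kz)) expr0n sqr_ge0.
- have [zk|kz] := leqP k z; first by rewrite natrB//; lra.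
  by rewrite (eqP (ltnW kz)) expr0n sqr_ge0.
Qed.

Let q0 : 0 <= q. Proof. by rewrite mulr_ge0// mass_ge0. Qed.

(** Of the two truncated means of [Z - k], the one on the side of [k] where the
    mean [lam] lies is at most [s], and the other is at most [q * lam / s ^ 2]: it
    equals [q] minus [|x|] times a tail probability, and this probability is at
    least [|x| / lam] times the truncated mean itself.  As
    [s ^ 2 = lam + x ^ 2 >= lam], the product is at most
    [q * lam / s <= q * sqrt lam]. *)
Lemma poisson_tails_product : m * p <= Num.sqrt lam * q.
Proof.
have [ms ps] := ms_ps.
have sl0 : 0 < Num.sqrt lam by rewrite sqrtr_gt0.
have sl2 : Num.sqrt lam ^+ 2 = lam by rewrite sqr_sqrtr// ltW.
have sls : Num.sqrt lam <= s.
  by rewrite ler_sqrt ?lerDl ?sqr_ge0// addr_ge0 ?sqr_ge0// ltW.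
suff mps : m * p * s <= lam * q.
  rewrite -(ler_pM2r sl0); apply: (@le_trans _ _ (m * p * s)).
    by rewrite ler_wpM2l// mulr_ge0.
  by rewrite [leRHS]mulrAC -expr2 sl2.
rewrite -(ler_pM2r s0).
have -> : m * p * s * s = m * p * s ^+ 2 by ring.
have [x0|x0] := leP 0 x.
  have H : m * s ^+ 2 <= lam * q.
    rewrite s2; have := ler_wpM2l x0 (below x0); have := poisson_lower_tailE; nra.
  by rewrite mulrAC ler_pM// mulr_ge0 ?sqr_ge0.
have H : p * s ^+ 2 <= lam * q.
  have x1 : 0 <= - x by rewrite oppr_ge0 ltW.
  rewrite s2; have := ler_wpM2l x1 (above (ltW x0)).
  have := poisson_lower_tailE; have := poisson_tails_diff; nra.
by rewrite -mulrA [X in _ <= X]mulrC ler_pM// mulr_ge0 ?sqr_ge0.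
Qed.

End Level.

Section Solution.
Context (h : nat -> R).
Hypothesis h_lip : forall i j, `|h i - h j| <= `|i%:R - j%:R|.

Lemma L1_lipschitz_poisson : L1 P (fun w => h (Z w)).
Proof.
apply: (Ile (g2 := fun z => `|h 0| + z%:R)); first exact: ID.
move=> z; have := h_lip z 0; rewrite subr0 (ger0_norm (ler0n _ _)) => hz.
by rewrite -(subrK (h 0) (h z)) addrC (le_trans (ler_normD _ _))// lerD2l.
Qed.

Let Ih : I h := L1_lipschitz_poisson.

(* The solution obtained by solving the recurrence forward from 0.  As
   [0.-1 = 0], its value at 0 repeats the one at 1. *)
Let W k := E (fun z => (h z - E h) * (z <= k)%N%:R).
Let sol k := W k.-1 / (lam * mass P Z k.-1).

Let IW k : I (fun z => (h z - E h) * (z <= k)%N%:R).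
Proof. by apply: IMbool; apply: IB. Qed.

Let WS k : W k.+1 = W k + (h k.+1 - E h) * mass P Z k.+1.
Proof.
rewrite -[mass P Z _]/(E (fun z => (z == k.+1)%:R)).
rewrite -EZ; last exact: (Ibool (fun z => z == k.+1)).
rewrite -ED//; last exact: IZ (Ibool (fun z => z == k.+1)).
congr Emean; apply/funext => w; rewrite leq_eqVlt ltnS.
have [->|] := eqVneq (Z w) k.+1; first by rewrite ltnn mulr0 add0r.
by rewrite mulr0 addr0.
Qed.

Let W0 : W 0 = (h 0 - E h) * mass P Z 0.
Proof.
rewrite -[mass P Z _]/(E (fun z => (z == 0)%:R)).
rewrite -EZ; last exact: (Ibool (fun z => z == 0)%N).
congr Emean; apply/funext => w; rewrite leqn0.
by have [->|] := eqVneq (Z w) 0%N; rewrite ?mulr0.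
Qed.

Let lamN : lam != 0. Proof. exact: lt0r_neq0. Qed.
Let massN k : mass P Z k != 0. Proof. exact: lt0r_neq0. Qed.

Let sol_eq k : lam * sol k.+1 - k%:R * sol k = h k - E h.
Proof.
rewrite /sol/=; case: k => [|k] /=.
  by rewrite mul0r subr0 W0; field; rewrite lamN massN.
have -> : k.+1%:R * (W k / (lam * mass P Z k)) = W k / mass P Z k.+1.
  have gen (c a q : R) : c != 0 -> q != 0 -> c * (a / (c * q)) = a / q.
    by move=> c0 q0; field; rewrite c0 q0.
  by rewrite -massS gen// pnatr_eq0.
by rewrite WS; field; rewrite lamN massN.
Qed.

(* With [A] and [B] the contributions to [E h - h n] of the values of [Z] below
   and above [n], the increment of the solution at [n] is
   [- (A p + B m) / (lam n P(Z = n))]; a Lipschitz [h] has [|A| <= m] and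
   [|B| <= p], so the product of the two tails is what matters. *)
Let sol_lip k : `|sol k.+1 - sol k| <= 2 / Num.sqrt lam.
Proof.
have sl0 : 0 < Num.sqrt lam by rewrite sqrtr_gt0.
case: k => [|k]; first by rewrite /sol subrr normr0 divr_ge0// ltW.
set n := k.+1.
have n0 : n%:R != 0 :> R by rewrite pnatr_eq0.
pose A := E (fun z => (h z - h n) * (z < n)%N%:R).
pose B := E (fun z => (h z - h n) * (n < z)%N%:R).
pose m := E (fun z => (n - z)%:R).
pose p := E (fun z => (z - n)%:R).
pose F := E (fun z => (z < n)%N%:R).
have Ihn : I (fun z => h z - h n) by exact: IB.
have bnd z : `|h z - h n| <= `|z%:R - n%:R| by exact: h_lip.
have Am : `|A| <= m.
  apply: Emean_norm_le.
  - exact: (measurable_fun_nat (fun z => (h z - h n) * (z < n)%N%:R)).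
  - exact: L1_lower_tail.
  - move=> w; case: ltnP => [zn|_]; last by rewrite mulr0 normr0.
    by rewrite mulr1 (le_trans (bnd _))// distrC -natrB 1?ltnW// ger0_norm.
have Bp : `|B| <= p.
  apply: Emean_norm_le.
  - exact: (measurable_fun_nat (fun z => (h z - h n) * (n < z)%N%:R)).
  - exact: L1_upper_tail.
  - move=> w; case: ltnP => [zn|_]; last by rewrite mulr0 normr0.
    by rewrite mulr1 (le_trans (bnd _))// -natrB 1?ltnW// ger0_norm.
have AB : E h = A + B + h n.
  have IA : I (fun z => (h z - h n) * (z < n)%N%:R) by exact: IMbool.
  have IB' : I (fun z => (h z - h n) * (n < z)%N%:R) by exact: IMbool.
  have -> : h n = E (fun=> h n) by rewrite Ecst.
  rewrite -ED// -ED//; last exact: ID.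
  congr Emean; apply/funext => w.
  by have [zn|zn|->] := ltngtP (Z w) n; rewrite /=; ring.
have Wk : W k = A + (h n - E h) * F.
  rewrite -EZ; last exact: Ibool.
  rewrite -ED; [|exact: IMbool|exact/IZ/Ibool].
  by congr Emean; apply/funext => w; rewrite ltnS; ring.
have := WS k; rewrite -/n Wk => WSn.
have pm : p = m + (lam - n%:R) := poisson_tails_diff n.
have mF : m = n%:R * mass P Z n - (lam - n%:R) * F := poisson_lower_tailE n.
have := poisson_tails_product n; rewrite -/m -/p => mp.
have m0 : 0 <= m by exact: Emean_ge0.
have p0 : 0 <= p by exact: Emean_ge0.
have -> : sol n.+1 - sol n = - (A * p + B * m) / (lam * (n%:R * mass P Z n)).
  rewrite /sol/= -/n WSn Wk -(massS k) -/n pm.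
  move: (massN n) mF n0 AB; rewrite -/n.
  move: (mass P Z n) (n%:R : R) (h n) => pn c hn pn0 -> c0 ->; field.
  by rewrite lamN pn0 c0.
have q0 : 0 < n%:R * mass P Z n by rewrite mulr_gt0// ltr0n.
rewrite normrM normrN normfV (gtr0_norm (mulr_gt0 lam0 q0)).
rewrite ler_pdivrMr ?mulr_gt0//.
apply: (@le_trans _ _ (2 * (m * p))).
  apply: le_trans (ler_normD _ _) _; rewrite !normrM.
  rewrite (ger0_norm p0) (ger0_norm m0).
  by have := ler_wpM2r p0 Am; have := ler_wpM2r m0 Bp; lra.
have -> : 2 / Num.sqrt lam * (lam * (n%:R * mass P Z n)) =
  2 * (Num.sqrt lam * (n%:R * mass P Z n)).
  have {2}-> : lam = Num.sqrt lam ^+ 2 by rewrite sqr_sqrtr// ltW.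
  by field; exact: lt0r_neq0.
by rewrite ler_pM2l.
Qed.

(** The factor [1 / sqrt lam], uniform over Lipschitz [h], is what gives the
    square root of the mean in front of the final bound. *)
Lemma poisson_stein : exists f : nat -> R,
  (forall k, lam * f k.+1 - k%:R * f k = h k - Emean P (fun w => h (Z w))) /\
  (forall k, `|f k.+1 - f k| <= 2 / Num.sqrt lam).
Proof. by exists sol; split. Qed.

End Solution.
End PoissonStein.

(** * Absolutely continuous functions with slope at most one *)

Section AbsolutelyContinuous.
Context (R : realType) (h : R -> R).
Local Notation mu := (@lebesgue_measure R).

Lemma derivable_straddle (c e : R) : 0 < e -> derivable h c 1 ->
  `|h^`()%classic c| <= 1 ->
  exists2 r : R, 0 < r &
    forall y, `|y - c| < r -> `|h y - h c| <= (1 + e) * `|y - c|.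
Proof.
move=> e0 dh h1.
have /cvgrPdist_lt/(_ e e0) :
    (fun t => t^-1 *: ((h \o shift c) (t *: (1 : R)) - h c)) @ 0^'
    --> 'D_1 h c by exact: dh.
rewrite near_withinE => -[r /= r0 hr]; exists r => // y yr.
have [->|yc] := eqVneq y c; first by rewrite !subrr normr0 mulr0.
have := hr (y - c); rewrite /ball_/= sub0r normrN => /(_ yr).
rewrite subr_eq0 => /(_ yc).
rewrite scaler1 subrK -derive1E => H.
have : `|(y - c)^-1 *: (h y - h c)| <= 1 + e.
  rewrite -(subrKC (derive1 h c) (_ *: _)) (le_trans (ler_normD _ _))//.
  by rewrite lerD// distrC ltW.
rewrite normrZ normfV -ler_pdivlMl ?invr_gt0 ?normr_gt0 ?subr_eq0// invrK.
by rewrite mulrC.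
Qed.

(** A finite chain of ordered intervals inside [O], ending before [x], that
    accounts for the growth of [h] between [a] and [x] beyond slope [1 + e]. *)
Definition chain (O : set R) (a e x : R) (s : seq (R * R)) : Prop :=
  [/\ forall p, p \in s -> p.1 <= p.2 <= x,
      forall p, p \in s -> `]p.1, p.2[%classic `<=` O,
      pairwise (fun p q => p.2 <= q.1) s &
      `|h x - h a| <= (1 + e) * (x - a) + \sum_(p <- s) `|h p.2 - h p.1|].

Lemma chain_straddle O a e x y z s : x <= y -> y <= z ->
  `|h x - h y| <= (1 + e) * (y - x) -> `|h z - h y| <= (1 + e) * (z - y) ->
  chain O a e x s -> chain O a e z s.
Proof.
move=> xy yz hxy hyz [s1 s2 s3 s4]; split => //.
  by move=> p /s1 /andP[-> px]; rewrite (le_trans px)// (le_trans xy).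
have -> : h z - h a = (h z - h y) + ((h y - h x) + (h x - h a)) by ring.
apply: le_trans (ler_normD _ _) _.
apply: le_trans (lerD hyz (ler_normD _ _)) _.
rewrite distrC in hxy.
apply: le_trans (lerD (lexx _) (lerD hxy s4)) _.
by rewrite le_eqVlt; apply/orP; left; apply/eqP; ring.
Qed.

Lemma chain_rcons O a e x z s : 0 < e -> x <= z -> `]x, z[%classic `<=` O ->
  chain O a e x s -> chain O a e z (rcons s (x, z)).
Proof.
move=> e0 xz xzO [s1 s2 s3 s4]; split => //.
- move=> p; rewrite mem_rcons inE => /predU1P[->/=|/s1/andP[-> px]].
    by rewrite xz lexx.
  by rewrite (le_trans px).
- by move=> p; rewrite mem_rcons inE => /predU1P[->//|/s2].
- rewrite pairwise_rcons s3 andbT; apply/allP => p /s1 /andP[_ px] /=.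
  exact: px.
rewrite -cats1 big_cat big_seq1/=.
have -> : h z - h a = (h z - h x) + (h x - h a) by ring.
apply: le_trans (ler_normD _ _) _.
rewrite addrA [leRHS]addrC lerD2l (le_trans s4)// lerD2r ler_wpM2l ?lerD2r//.
by rewrite addr_ge0// ltW.
Qed.

(** Creeping along [a, b]: the supremum of the points reached by a chain can
    always be passed, by the straddle estimate at points outside [O], and by
    adding an interval to the chain at points of the open set [O]. *)
Lemma chain_exists (O : set R) a b e : 0 < e -> a <= b -> open O ->
  (forall x, ~ O x -> derivable h x 1 /\ `|h^`()%classic x| <= 1) ->
  exists s, chain O a e b s.
Proof.
move=> e0 ab oO hO.
pose S := [set x | a <= x <= b /\ exists s, chain O a e x s].
have Sa : S a.
  split; first by rewrite lexx.
  by exists [::]; split => //; rewrite !subrr normr0 mulr0 big_nil addr0.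
have ubS : has_ubound S by exists b => x [/andP[]].
have supS : has_sup S by split; [exists a|].
set c := sup S.
have ac : a <= c by exact: ub_le_sup.
have cb : c <= b by apply: ge_sup; [exists a|move=> x [/andP[]]].
have [r r0 step] : exists2 r, 0 < r & forall x z, c - r < x -> x <= c -> c <= z ->
    z < c + r -> (exists s, chain O a e x s) -> exists s, chain O a e z s.
  have [Oc|/hO[dh h1]] := pselect (O c).
    have /nbhs_ballP[r /= r0 rO] : nbhs c O by exact: open_nbhs_nbhs.
    exists r => // x z rx xc cz zr [s sx]; exists (rcons s (x, z)).
    apply: chain_rcons => //; first exact: le_trans cz.
    move=> t /=; rewrite in_itv/= => /andP[xt tz]; apply: rO.
    by rewrite /ball/= ltr_norml; apply/andP; split; lra.
  have [r r0 hr] := derivable_straddle e0 dh h1.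
  exists r => // x z rx xc cz zr [s sx]; exists s.
  apply: (chain_straddle xc cz _ _ sx).
    have := hr x; rewrite distrC ger0_norm ?subr_ge0//; apply; lra.
  have := hr z; rewrite [`|z - c|]ger0_norm ?subr_ge0//; apply; lra.
have [x [/andP[ax xb] sx] cx] := sup_adherent r0 supS.
have xc : x <= c by apply: ub_le_sup => //; split=> //; rewrite ax.
pose z := Order.min b (c + r / 2).
have cz : c <= z by rewrite le_min cb lerDl divr_ge0// ltW.
have zr : z < c + r by rewrite gt_min ltrD2l ltr_pdivrMr// ltr_pMr// ltr1n orbT.
have sz := step _ _ cx xc cz zr sx.
have : z <= c.
  apply: ub_le_sup => //; split => //; rewrite (le_trans ac cz)/=.
  by rewrite ge_min lexx.
rewrite ge_min => /orP[bc|]; last by rewrite gerDl leNgt divr_gt0.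
by have <- : z = b by apply/min_idPl; rewrite (le_trans bc)// lerDl divr_ge0// ltW.
Qed.

Lemma chain_trivIset O a e x s : chain O a e x s -> trivIset setT
  (fun i : 'I_(size s) =>
    `](nth (0, 0) s i).1, (nth (0, 0) s i).2[%classic : set R).
Proof.
move=> [s1 s2 s3 _].
have E (i j : 'I_(size s)) : (i < j)%N ->
    (nth (0, 0) s i).2 <= (nth (0, 0) s j).1.
  move=> ij; move/(pairwiseP (0, 0)): s3; apply => //; exact: ltn_ord.
move=> i j _ _ [t []] /=; rewrite !in_itv/= => /andP[i1 i2] /andP[j1 j2].
have [/E le|/E le|/val_inj//] := ltngtP i j.
- by have := lt_trans (le_lt_trans le j1) i2; rewrite ltxx.
- by have := lt_trans (le_lt_trans le i1) j2; rewrite ltxx.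
Qed.
Lemma chain_length O a e x s (l : R) : measurable O -> (mu O < l%:E)%E ->
  chain O a e x s ->
  \sum_(i < size s) ((nth (0, 0) s i).2 - (nth (0, 0) s i).1) < l.
Proof.
move=> mO Ol sx; have tF := chain_trivIset sx; have [s1 s2 s3 _] := sx.
rewrite -lte_fin; apply: le_lt_trans Ol.
set F := (fun i : 'I_(size s) => _ : set R) in tF.
have mF i : measurable (F i) by exact: measurable_itv.
apply: (@le_trans _ _ (mu (\big[setU/set0]_(i < size s) F i))).
  rewrite measure_bigsetU_ord// -sumEFin; apply: lee_sum => i _.
  have len (u v : R) : ((v - u)%:E <= mu `]u, v[)%E.
    rewrite lebesgue_measure_itv/= lte_fin; case: ltP => // vu.
    by rewrite lee_fin subr_le0.
  exact: len.
apply: le_measure; rewrite ?inE//.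
  by apply: bigsetU_measurable => i _; exact: mF.
apply: (big_ind (fun A => A `<=` O)) => [t []|A B AO BO t [/AO|/BO]//|i _].
by apply: s2; rewrite mem_nth.
Qed.

(** The points without derivative are covered by an open set so small that the
    intervals of a chain contribute at most [e], by absolute continuity; outside
    it the growth has slope at most [1 + e]. *)
Lemma wasserstein_lipschitz : wasserstein_test h ->
  forall a b, a <= b -> `|h b - h a| <= b - a.
Proof.
move=> [ach [E [mE E0 sE]] hE] a b ab.
suff bound e : 0 < e -> `|h b - h a| <= (1 + e) * (b - a) + e.
  apply/ler_addgt0Pr => e e0.
  have c0 : 0 < b - a + 1 by rewrite ltr_wpDl ?subr_ge0.
  apply: le_trans (bound (e / (b - a + 1)) _) _; first exact: divr_gt0.
  rewrite le_eqVlt; apply/orP; left; apply/eqP; field; exact: lt0r_neq0.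
move=> e0; have [delta delta0 hdelta] := ach e e0.
have muEy : (mu E < +oo)%E by rewrite E0 ltry.
have [V [oV EV Vd]] := lebesgue_regularity_outer mE muEy delta0.
have mV : measurable V by exact: open_measurable.
have muV : (mu V < delta%:E)%E.
  have -> : (mu V = mu (V `\` E) + mu (V `&` E))%E by exact: measureDI.
  by rewrite (setIidr EV) E0 adde0.
have hV x : ~ V x -> derivable h x 1 /\ `|h^`()%classic x| <= 1.
  move=> nVx; have dx : derivable h x 1.
    by apply: contrapT => nd; apply: nVx; apply: EV; apply: sE.
  by split => //; exact: hE.
have [s sb] := chain_exists e0 ab oV hV; have [s1 _ _ s4] := sb.
apply: (le_trans s4); rewrite lerD2l ltW// (big_nth (0, 0)) big_mkord.
apply: (hdelta _ (fun i => (nth (0, 0) s i).1) (fun i => (nth (0, 0) s i).2)).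
- by move=> i; have /andP[] := s1 _ (mem_nth (0, 0) (ltn_ord i)).
- exact: chain_trivIset sb.
- exact: chain_length sb.
Qed.

End AbsolutelyContinuous.

(** * Characteristic functions of integer-valued variables *)

Section RootsOfUnity.
Context (R : realType).

(** Since 2 sin(x / 2) cos(j x) is a difference of consecutive values of
    sin((j - 1/2) x). *)
Lemma sum_cos_telescope (x : R) n :
  2 * sin (x / 2) * \sum_(j < n) cos (x * j%:R) =
  sin (x * n%:R - x / 2) + sin (x / 2).
Proof.
elim: n => [|n IH]; first by rewrite big_ord0 !mulr0 sub0r sinN addNr.
rewrite big_ord_recr/=; set S := \sum_(_ < n) _ in IH *.
transitivity (2 * sin (x / 2) * S + 2 * sin (x / 2) * cos (x * n%:R)); first by ring.
rewrite IH.
have -> : x * n.+1%:R - x / 2 = x * n%:R + x / 2 by rewrite -[n.+1%:R]natr1; field.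
by rewrite sinB sinD; ring.
Qed.

Lemma sum_cos_root (M m : nat) : (0 < m < M)%N ->
  \sum_(j < M) cos (2 * pi * m%:R / M%:R * j%:R) = 0 :> R.
Proof.
move=> /andP[m0 mM]; set x : R := 2 * pi * m%:R / M%:R.
have M0 : (0 : R) < M%:R by rewrite ltr0n (leq_trans _ mM).
have s0 : 0 < sin (x / 2).
  have -> : x / 2 = pi * (m%:R / M%:R) by rewrite /x; field; rewrite lt0r_neq0.
  apply: sin_gt0_pi; rewrite mulr_gt0 ?pi_gt0 ?divr_gt0 ?ltr0n//=; last first.
    exact: ltn_trans mM.
  by rewrite gtr_pMr ?pi_gt0// ltr_pdivrMr// mul1r ltr_nat.
have s2 : 2 * sin (x / 2) != 0.
  by apply: mulf_neq0; [rewrite pnatr_eq0|exact: (lt0r_neq0 s0)].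
apply: (mulfI s2); rewrite sum_cos_telescope mulr0.
have -> : x * M%:R - x / 2 = - (x / 2) + pi *+ 2 *+ m.
  rewrite /x -[_ *+ m]mulr_natr -[pi *+ 2]mulr_natl; field.
  by rewrite lt0r_neq0.
by rewrite (periodicn (@sinD2pi R)) sinN addNr.
Qed.

(** The indicator of [u = k] modulo [M], as an average of cosines. *)
Definition root_average (M k u : nat) : R :=
  M%:R^-1 * \sum_(j < M) cos (2 * pi / M%:R * j%:R * (u%:R - k%:R)).

Lemma root_average_le1 M k u : `|root_average M k u| <= 1.
Proof.
rewrite normrM normfV [`|M%:R|]ger0_norm//.
have [->|M0] := eqVneq M 0%N; first by rewrite big_ord0 normr0 mulr0.
rewrite ler_pdivrMl; last by rewrite ltr0n lt0n.
rewrite mulr1.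
apply: (le_trans (ler_norm_sum _ _ _)).
apply: (@le_trans _ _ (\sum_(j < M) 1)); last by rewrite sumr_const card_ord.
by apply: ler_sum => j _; exact: cos_max.
Qed.

Lemma root_average_indicator M k u : (u < M)%N -> (k < M)%N ->
  root_average M k u = (u == k)%:R.
Proof.
move=> uM kM; have M0 : M%:R != 0 :> R by rewrite pnatr_eq0; case: M uM {kM}.
rewrite /root_average; have [->|uk] := eqVneq u k.
  rewrite subrr; under eq_bigr do rewrite mulr0 cos0.
  by rewrite sumr_const card_ord mulVf.
wlog lt_uk : u k uk uM kM / (u < k)%N => [H|].
  have [/H|ku|/eqP] := ltngtP u k; [exact| |by rewrite (negbTE uk)].
  rewrite -(H k u) ?[k == u]eq_sym//; congr (_ * _); apply: eq_bigr => j _.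
  by rewrite -cosN; congr cos; ring.
have kuM : (0 < k - u < M)%N.
  by rewrite subn_gt0 lt_uk (leq_ltn_trans (leq_subr _ _)).
rewrite (_ : \sum_(j < M) _ = 0) ?mulr0//.
rewrite -[RHS](sum_cos_root kuM).
apply: eq_bigr => j _; rewrite -cosN natrB 1?ltnW//; congr cos; ring.
Qed.

End RootsOfUnity.

Section Characteristic.
Context (R : realType).

Definition charf d (T : measurableType d) (P : probability T R) (U : T -> nat)
  (t : R) : R[i] := Cmean P (fun w => expi (t * (U w)%:R)).

Lemma L1_cos d (T : measurableType d) (P : probability T R) (U : T -> nat)
  (phi : nat -> R) : measurable_fun setT U -> L1 P (fun w => cos (phi (U w))).
Proof.
move=> mU; apply: (L1_bounded (c := 1)) => [|w]; last exact: cos_max.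
exact: (measurable_fun_nat (fun k => cos (phi k))).
Qed.

Lemma L1_sin d (T : measurableType d) (P : probability T R) (U : T -> nat)
  (phi : nat -> R) : measurable_fun setT U -> L1 P (fun w => sin (phi (U w))).
Proof.
move=> mU; apply: (L1_bounded (c := 1)) => [|w]; last exact: sin_max.
exact: (measurable_fun_nat (fun k => sin (phi k))).
Qed.

Arguments L1_cos {d T} P {U} phi.
Arguments L1_sin {d T} P {U} phi.

Lemma charf_mass d1 (T1 : measurableType d1) (P1 : probability T1 R)
    d2 (T2 : measurableType d2) (P2 : probability T2 R)
    (U : T1 -> nat) (V : T2 -> nat) t :
  measurable_fun setT U -> measurable_fun setT V ->
  mass P1 U =1 mass P2 V -> charf P1 U t = charf P2 V t.
Proof.
move=> mU mV UV; rewrite /charf /Cmean/=.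
rewrite (Emean_mass_eq mU mV UV (phi := fun k => cos (t * k%:R)))//; last first.
  exact: (L1_cos P1 (fun k => t * k%:R)).
rewrite (Emean_mass_eq mU mV UV (phi := fun k => sin (t * k%:R)))//.
exact: (L1_sin P1 (fun k => t * k%:R)).
Qed.

Lemma charfD d (T : measurableType d) (P : probability T R) (U V : T -> nat) t :
  measurable_fun setT U -> measurable_fun setT V -> indep P U V ->
  charf P (fun w => (U w + V w)%N) t = charf P U t * charf P V t.
Proof.
move=> mU mV UV; rewrite /charf /Cmean.
have c W : measurable_fun setT W -> L1 P (fun w => cos (t * (W w)%:R)).
  by move=> mW; exact: (L1_cos P (fun k => t * k%:R)).
have s W : measurable_fun setT W -> L1 P (fun w => sin (t * (W w)%:R)).
  by move=> mW; exact: (L1_sin P (fun k => t * k%:R)).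
have L (f g : nat -> R) := L1_indepM (f := f) (g := g) mU mV UV.
have M (f g : nat -> R) := Emean_indepM (f := f) (g := g) mU mV UV.
pose co (k : nat) := cos (t * k%:R); pose si (k : nat) := sin (t * k%:R).
apply/eqP; rewrite eq_complex /=; apply/andP; split; apply/eqP.
- under eq_fun do rewrite natrD mulrDr cosD.
  rewrite EmeanB; [|exact: (L co co (c _ mU) (c _ mV))
                   |exact: (L si si (s _ mU) (s _ mV))].
  by rewrite (M co co (c _ mU) (c _ mV)) (M si si (s _ mU) (s _ mV)).
- under eq_fun do rewrite natrD mulrDr sinD.
  rewrite EmeanD; [|exact: (L si co (s _ mU) (c _ mV))
                   |exact: (L co si (c _ mU) (s _ mV))].
  rewrite (M si co (s _ mU) (c _ mV)) (M co si (c _ mU) (s _ mV)).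
  by rewrite addrC.
Qed.

Lemma Emean_cos_charf d (T : measurableType d) (P : probability T R)
    (U : T -> nat) t k : measurable_fun setT U ->
  Emean P (fun w => cos (t * ((U w)%:R - k))) =
  cos (t * k) * complex.Re (charf P U t) + sin (t * k) * complex.Im (charf P U t).
Proof.
move=> mU; rewrite /charf/=.
have ic := L1_cos P (fun k => t * k%:R) mU.
have isn := L1_sin P (fun k => t * k%:R) mU.
rewrite -!EmeanZ// -EmeanD; [|exact: L1Z|exact: L1Z].
by congr Emean; apply/funext => w; rewrite mulrBr cosB; ring.
Qed.

Lemma mass_root_average d (T : measurableType d) (P : probability T R)
    (U : T -> nat) k : measurable_fun setT U ->
  (fun M => Emean P (fun w => root_average R M k (U w))) @ \oo --> mass P U k.
Proof.
move=> mU; apply: (Emean_dominated_cvg (G := fun=> 1)).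
- by move=> n; exact: measurable_fun_nat.
- exact: (measurable_fun_nat (fun j => (j == k)%:R)).
- exact: L1_cst.
- by move=> n w; exact: root_average_le1.
- move=> w; apply: cvg_near_cst; exists (maxn (U w) k).+1 => // n /=.
  by rewrite gtn_max => /andP[Un kn]; rewrite root_average_indicator.
Qed.

(** Uniqueness of characteristic functions, for a two-component mixture: each
    mass is a limit of averages of characteristic functions, and the mixture
    relation passes through the averages. *)
Lemma charf_mixture d1 (T1 : measurableType d1) (P1 : probability T1 R)
    d2 (T2 : measurableType d2) (P2 : probability T2 R)
    d3 (T3 : measurableType d3) (P3 : probability T3 R)
    (U : T1 -> nat) (V : T2 -> nat) (W : T3 -> nat) (rho : R) :
  measurable_fun setT U -> measurable_fun setT V -> measurable_fun setT W ->
  (forall t, charf P1 U t =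
     rho%:C%C * charf P2 V t + (1 - rho)%:C%C * charf P3 W t) ->
  forall k, mass P1 U k = rho * mass P2 V k + (1 - rho) * mass P3 W k.
Proof.
move=> mU mV mW UVW k.
have Ecos (t : R) : Emean P1 (fun w => cos (t * ((U w)%:R - k%:R))) =
    rho * Emean P2 (fun w => cos (t * ((V w)%:R - k%:R))) +
    (1 - rho) * Emean P3 (fun w => cos (t * ((W w)%:R - k%:R))).
  rewrite !Emean_cos_charf// UVW.
  by case: (charf P2 V t) => a b; case: (charf P3 W t) => a' b' /=; ring.
have cU := mass_root_average (P := P1) (k := k) mU.
have cVW : (fun M => rho * Emean P2 (fun w => root_average R M k (V w)) +
    (1 - rho) * Emean P3 (fun w => root_average R M k (W w))) @ \oo -->
    rho * mass P2 V k + (1 - rho) * mass P3 W k.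
  by apply: cvgD; (apply: cvgM; [exact: cvg_cst|exact: mass_root_average]).
suff E : (fun M => Emean P1 (fun w => root_average R M k (U w))) =
  (fun M => rho * Emean P2 (fun w => root_average R M k (V w)) +
    (1 - rho) * Emean P3 (fun w => root_average R M k (W w))).
  by rewrite E in cU; exact: (cvg_unique _ cU cVW).
have Eavg d (T : measurableType d) (P : probability T R) (X : T -> nat) M :
    measurable_fun setT X -> Emean P (fun w => root_average R M k (X w)) =
    M%:R^-1 * \sum_(j < M)
      Emean P (fun w => cos (2 * pi / M%:R * j%:R * ((X w)%:R - k%:R))).
  move=> mX; have iX (j : 'I_M) :
      L1 P (fun w => cos (2 * pi / M%:R * j%:R * ((X w)%:R - k%:R))).
    exact: (L1_cos P (fun u => 2 * pi / M%:R * j%:R * (u%:R - k%:R)) mX).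
  by rewrite EmeanZ ?Emean_sum//; exact: L1_sum.
apply/funext => M; rewrite !Eavg//.
rewrite mulrCA [X in _ = _ + X]mulrCA -mulrDr; congr (_ * _).
by rewrite !mulr_sumr -big_split; apply: eq_bigr => j _; rewrite Ecos.
Qed.

End Characteristic.

(** * Sums of independent integer-valued variables *)

Lemma measurable_sumn d (T : measurableType d) (I : Type) (s : seq I)
    (U : I -> T -> nat) : (forall i, measurable_fun setT (U i)) ->
  measurable_fun setT (fun w => \sum_(i <- s) U i w)%N.
Proof.
move=> mU; elim: s => [|i s IH].
  by under eq_fun do rewrite big_nil; exact: measurable_cst.
by under eq_fun do rewrite big_cons; exact: measurable_fun_addn.
Qed.

Definition partial_sum (T : Type) (X : nat -> T -> nat) (s : seq nat) (w : T) :
  nat := (\sum_(j <- s) X j w)%N.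

Lemma partial_sum_iota (T : Type) (X : nat -> T -> nat) n w :
  partial_sum X (iota 0 n) w = (\sum_(j < n) X j w)%N.
Proof.
by rewrite /partial_sum -(big_mkord xpredT (fun i => X i w)) /index_iota subn0.
Qed.

Definition random_sum (T : Type) (X : nat -> T -> nat) (N : T -> nat) (w : T) :
  nat := partial_sum X (iota 0 (N w)) w.

Section IndependentSums.
Context d (T : measurableType d) (R : realType) (P : probability T R).
Context (X : nat -> T -> nat).
Hypothesis mX : forall j, measurable_fun setT (X j).
Hypothesis indepX : mutually_independent P X.

Lemma measurable_partial_sum s : measurable_fun setT (partial_sum X s).
Proof. exact: measurable_sumn. Qed.

Let hits (r : seq nat) (c : nat -> nat) (w : T) : R :=
  \prod_(j <- r) (X j w == c j)%:R.

Let hitsE r c : hits r c = \1_(\big[setI/setT]_(j <- r) (X j @^-1` [set c j])).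
Proof.
apply/funext => w; rewrite /hits; elim: r => [|j r IH].
  by rewrite !big_nil indicE in_setT.
rewrite !big_cons IH !indicE in_setI -mulnb natrM; congr (_ * _).
have [Xc|/eqP Xc] := eqVneq (X j w) (c j); first by rewrite mem_set.
by rewrite memNset.
Qed.

Let measurable_hits r (c : nat -> nat) :
  measurable (\big[setI/setT]_(j <- r) (X j @^-1` [set c j])).
Proof.
elim: r => [|j r IH]; first by rewrite big_nil.
rewrite big_cons; apply: measurableI => //.
by rewrite -[X in measurable X]setTI; exact: mX.
Qed.

Let L1_hits r c : L1 P (hits r c).
Proof. by rewrite hitsE; apply: integrable_indic. Qed.

Let Emean_hits r c : uniq r ->
  Emean P (hits r c) = \prod_(j <- r) mass P (X j) (c j).
Proof.
move=> ur; rewrite hitsE /Emean expectation_indic//.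
rewrite (indepX (A := fun j => [set c j]) ur)//.
rewrite (eq_bigr (fun j => (mass P (X j) (c j))%:E)) ?prodEFin//.
by move=> j _; rewrite -massE.
Qed.

Let shift_eq (x y b : nat) :
  (x + y == b)%:R = \sum_(i < b.+1) (y == b - i)%N%:R * (x == i)%:R :> R.
Proof.
have [xb|bx] := leqP x b; last first.
  rewrite gtn_eqF ?ltn_addr// big1// => i _.
  by rewrite [x == _](gtn_eqF (leq_trans (ltn_ord i) bx)) mulr0.
rewrite (bigD1 (Ordinal (xb : (x < b.+1)%N)))//= eqxx mulr1 big1 ?addr0.
  by rewrite -(eqn_add2l x y) subnKC.
move=> i /eqP ix; case: (x =P i :> nat) => [xi|]; last by rewrite mulr0.
by case: ix; apply/val_inj.
Qed.

(* The induction on [s] has to carry along events on the variables outside [s],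
   since peeling a summand off [s] turns it into such an event. *)
Let joint s : forall r c b, uniq (s ++ r) ->
  Emean P (fun w => (partial_sum X s w == b)%:R * hits r c w) =
  mass P (partial_sum X s) b * \prod_(j <- r) mass P (X j) (c j).
Proof.
elim: s => [|a s IH] r c b u.
  have E : partial_sum X [::] = fun=> 0%N.
    by apply/funext => w; rewrite /partial_sum big_nil.
  by rewrite /mass E EmeanZ ?Emean_cst ?Emean_hits.
have conv r' c' : uniq ((a :: s) ++ r') ->
    Emean P (fun w => (partial_sum X (a :: s) w == b)%:R * hits r' c' w) =
    (\sum_(i < b.+1) mass P (partial_sum X s) (b - i) * mass P (X a) i) *
      \prod_(j <- r') mass P (X j) (c' j).
  move=> u'.
  (* The index [a] moves from the sum to the events, with value [i]. *)
  pose ci (i : nat) j := if j == a then i else c' j.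
  have u'' : uniq (s ++ a :: r') by rewrite -cat1s uniq_catCA.
  have ar : a \notin r' by move: u'; rewrite /= mem_cat negb_or => /andP[/andP[]].
  have eq_on (F : nat -> nat -> R) i : \prod_(j <- r') F j (ci i j) =
      \prod_(j <- r') F j (c' j).
    rewrite !big_seq; apply: eq_bigr => j jr; congr F; rewrite /ci.
    by case: eqP => // ja; rewrite -ja jr in ar.
  have E w : (partial_sum X (a :: s) w == b)%:R * hits r' c' w =
      \sum_(i < b.+1)
        (partial_sum X s w == (b - i)%N)%:R * hits (a :: r') (ci i) w.
    rewrite {1}/partial_sum big_cons shift_eq mulr_suml.
    apply: eq_bigr => i _; rewrite /hits big_cons -mulrA; congr (_ * _).
    by rewrite (eq_on (fun j k => (X j w == k)%:R)) /ci eqxx.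
  under eq_fun do rewrite E.
  rewrite Emean_sum; last first.
    move=> i; apply: (L1_bounded_mul (c := 1)) => //.
      exact: (measurable_fun_nat (fun k => (k == b - i)%N%:R)
        (measurable_partial_sum s)).
    by move=> w; case: (_ == _); rewrite ?normr1 ?normr0.
  rewrite mulr_suml; apply: eq_bigr => i _.
  rewrite IH// big_cons mulrA /ci eqxx.
  by congr (_ * _); rewrite (eq_on (fun j k => mass P (X j) k)).
rewrite conv//; congr (_ * _).
have := conv [::] c; rewrite cats0 big_nil mulr1 => <-.
  by rewrite /mass; congr Emean; apply/funext => w; rewrite /hits big_nil mulr1.
by move: u; rewrite cat_uniq => /andP[].
Qed.

Lemma indep_partial_sum a s : uniq (a :: s) -> indep P (X a) (partial_sum X s).
Proof.
move=> u i k; have u' : uniq (s ++ [:: a]) by rewrite cats1 rcons_uniq.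
have := joint (fun=> i) k u'; rewrite big_seq1 mulrC => <-.
congr Emean; apply/funext => w; rewrite mulrC.
by congr (_ * _); rewrite /hits big_seq1.
Qed.

Lemma mass_partial_sum_cons a s b : uniq (a :: s) ->
  mass P (partial_sum X (a :: s)) b =
  \sum_(i < b.+1) mass P (partial_sum X s) (b - i) * mass P (X a) i.
Proof.
move=> u; rewrite /mass /partial_sum.
under eq_fun do rewrite big_cons shift_eq.
rewrite Emean_sum; last first.
  move=> i; apply: (L1_bounded_mul (c := 1)).
  - exact: (measurable_fun_nat (fun k => (k == b - i)%N%:R)
      (measurable_partial_sum s)).
  - exact: L1_mass.
  - by move=> w; case: (_ == _); rewrite ?normr1 ?normr0.
apply: eq_bigr => i _; rewrite mulrC -[RHS](indep_partial_sum u).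
by congr Emean; apply/funext => w; rewrite mulrC.
Qed.

(** The convolution recursion only sees the number of summands. *)
Lemma mass_partial_sum s r : (forall j, mass P (X j) =1 mass P (X 0%N)) ->
  uniq s -> uniq r -> size s = size r ->
  mass P (partial_sum X s) =1 mass P (partial_sum X r).
Proof.
move=> X0; elim: s r => [|a s IH] [|b r]// us ur [sr] k.
rewrite !mass_partial_sum_cons//; apply: eq_bigr => i _.
rewrite !X0 (IH r)//; [by case/andP: us|by case/andP: ur].
Qed.

Lemma charf_partial_sum s t : uniq s ->
  charf P (partial_sum X s) t = \prod_(j <- s) charf P (X j) t.
Proof.
elim: s => [|a s IH] u.
  rewrite big_nil /charf /Cmean /partial_sum/=.
  under eq_fun do rewrite big_nil mulr0 cos0.
  under [X in (_ +i* Emean _ X)%C]eq_fun do rewrite big_nil mulr0 sin0.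
  by rewrite !Emean_cst.
rewrite big_cons -IH; last by case/andP: u.
rewrite -charfD//; [|exact: measurable_partial_sum|exact: indep_partial_sum].
by congr charf; apply/funext => w; rewrite /partial_sum big_cons.
Qed.

End IndependentSums.

(** * Approximate size-biasing of sums *)

Lemma lipschitz_of_step (R : realType) (f : nat -> R) (c : R) :
  (forall k, `|f k.+1 - f k| <= c) ->
  forall i j, `|f i - f j| <= c * `|i%:R - j%:R|.
Proof.
move=> fc; have up i j : (i <= j)%N -> `|f j - f i| <= c * (j%:R - i%:R).
  move=> /subnKC <-; elim: (j - i)%N => [|n IH].
    by rewrite addn0 !subrr normr0 mulr0.
  rewrite addnS -(subrK (f (i + n)%N) (f _)) -addrA.
  apply: (le_trans (ler_normD _ _)); apply: (le_trans (lerD (fc _) IH)).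
  by rewrite -[(i + n).+1%:R]natr1; lra.
move=> i j; have [ij|/ltnW ji] := leqP i j.
  by rewrite (distrC (f i)) (distrC i%:R) -(natrB _ ij) [`|_%:R|]ger0_norm// natrB// up.
by rewrite -(natrB _ ji) [`|_%:R|]ger0_norm// natrB// up.
Qed.

Section LipschitzBounds.
Context d (T : measurableType d) (R : realType) (P : probability T R).
Context (f : nat -> R) (c : R).
Hypothesis f_lip : forall i j, `|f i - f j| <= c * `|i%:R - j%:R|.

Lemma lipschitz_growth k : `|f k| <= `|f 0%N| + c * k%:R.
Proof.
rewrite -(subrK (f 0%N) (f k)) addrC (le_trans (ler_normD _ _))// lerD2l.
by rewrite (le_trans (f_lip _ _))// subr0 ger0_norm.
Qed.

Lemma L1_lipschitz (U : T -> nat) : measurable_fun setT U ->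
  L1 P (fun w => (U w)%:R) -> L1 P (fun w => f (U w)).
Proof.
move=> mU iU; apply: (L1_le (G := fun w => `|f 0%N| + c * (U w)%:R)).
- exact: measurable_fun_nat.
- by apply: L1D; [exact: L1_cst|exact: L1Z].
- by move=> w; exact: lipschitz_growth.
Qed.

Lemma natr_mul_dist1 (k : nat) : k%:R * `|k%:R - 1| = k%:R ^+ 2 - k%:R :> R.
Proof.
case: k => [|k]; first by rewrite mul0r expr0n subrr.
by rewrite -natr1 addrK ger0_norm//; ring.
Qed.

Context (X S : T -> nat).
Hypothesis mX : measurable_fun setT X.
Hypothesis mS : measurable_fun setT S.
Hypothesis iX2 : L1 P (fun w => (X w)%:R ^+ 2).

Lemma L1_of_square : L1 P (fun w => (X w)%:R).
Proof.
apply: (L1_le _ iX2); first exact: (measurable_fun_nat (fun k => k%:R)).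
by move=> w; rewrite ger0_norm// -natrX ler_nat; case: (X w) => // k; exact: leq_pmulr.
Qed.

Hypothesis XS : indep P X S.
Hypothesis iS : L1 P (fun w => (S w)%:R).

Lemma L1_indep_stein : L1 P (fun w => (X w)%:R * f (X w + S w)%N).
Proof.
have iX := L1_of_square.
have iXS : L1 P (fun w => (X w)%:R * (S w)%:R).
  exact: (L1_indepM (f := fun k => k%:R) (g := fun k => k%:R) mX mS XS).
apply: (L1_le (G := fun w =>
  `|f 0%N| * (X w)%:R + c * ((X w)%:R ^+ 2 + (X w)%:R * (S w)%:R))).
- apply: measurable_funM; first exact: (measurable_fun_nat (fun k => k%:R)).
  by apply: measurable_fun_nat; exact: measurable_fun_addn.
- by apply: L1D; [exact: L1Z|apply: L1Z; exact: L1D].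
- move=> w; rewrite normrM ger0_norm//.
  have := ler_wpM2l (ler0n R (X w)) (lipschitz_growth (X w + S w)).
  by rewrite natrD; lra.
Qed.

(** Removing one summand [X] from a sum: it is nearly its size-biased value,
    which exceeds 1 by E[X ^ 2] / E[X] - 1 on average. *)
Lemma Emean_indep_stein :
  `|Emean P (fun w => (X w)%:R * f (X w + S w)%N) -
    Emean P (fun w => (X w)%:R) * Emean P (fun w => f (S w).+1)|
  <= c * (Emean P (fun w => (X w)%:R ^+ 2) - Emean P (fun w => (X w)%:R)).
Proof.
have iX := L1_of_square.
have iS1 : L1 P (fun w => (S w).+1%:R).
  by under eq_fun do rewrite -natr1; apply: L1D => //; exact: L1_cst.
have mS1 : measurable_fun setT (fun w => (S w).+1).
  exact: (measurableT_comp (f := succn)).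
have ifS := L1_lipschitz mS1 iS1.
rewrite -(Emean_indepM (f := fun k => k%:R) (g := fun k => f k.+1) mX mS XS)//.
have -> : c * (Emean P (fun w => (X w)%:R ^+ 2) - Emean P (fun w => (X w)%:R)) =
    Emean P (fun w => c * ((X w)%:R ^+ 2 - (X w)%:R)).
  by rewrite EmeanZ ?EmeanB//; exact: L1B.
apply: Emean_dist_le.
- exact: L1_indep_stein.
- exact: (L1_indepM (f := fun k => k%:R) (g := fun k => f k.+1) mX mS XS).
- by apply: L1Z; exact: L1B.
- move=> w; rewrite -mulrBr normrM ger0_norm// -natr_mul_dist1 mulrCA.
  apply: ler_wpM2l => //; apply: (le_trans (f_lip _ _)); rewrite -natr1 natrD.
  by rewrite le_eqVlt; apply/orP; left; apply/eqP; congr (_ * `|_|); ring.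
Qed.

End LipschitzBounds.

Lemma Emean_mixture (R : realType)
    d1 (T1 : measurableType d1) (P1 : probability T1 R)
    d2 (T2 : measurableType d2) (P2 : probability T2 R)
    d3 (T3 : measurableType d3) (P3 : probability T3 R)
    (U : T1 -> nat) (V : T2 -> nat) (W : T3 -> nat) (rho : R) (phi : nat -> R) :
  measurable_fun setT U -> measurable_fun setT V -> measurable_fun setT W ->
  (forall k, mass P1 U k = rho * mass P2 V k + (1 - rho) * mass P3 W k) ->
  L1 P1 (fun w => phi (U w)) -> L1 P2 (fun w => phi (V w)) ->
  L1 P3 (fun w => phi (W w)) ->
  Emean P1 (fun w => phi (U w)) = rho * Emean P2 (fun w => phi (V w)) +
    (1 - rho) * Emean P3 (fun w => phi (W w)).
Proof.
move=> mU mV mW UVW iU iV iW; have cU := Emean_series mU iU.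
have cVW : (fun n => rho * (\sum_(k < n) phi k * mass P2 V k) +
    (1 - rho) * (\sum_(k < n) phi k * mass P3 W k)) @ \oo -->
    rho * Emean P2 (fun w => phi (V w)) + (1 - rho) * Emean P3 (fun w => phi (W w)).
  by apply: cvgD; (apply: cvgM; [exact: cvg_cst|exact: Emean_series]).
suff E : (fun n => \sum_(k < n) phi k * mass P1 U k) =
    (fun n => rho * (\sum_(k < n) phi k * mass P2 V k) +
    (1 - rho) * (\sum_(k < n) phi k * mass P3 W k)).
  by rewrite E in cU; exact: (cvg_unique _ cU cVW).
apply/funext => n; rewrite !mulr_sumr -big_split; apply: eq_bigr => k _.
by rewrite UVW/=; ring.
Qed.

Lemma sum_const_seq (R : realType) (I : Type) (s : seq I) (x : R) :
  \sum_(j <- s) x = (size s)%:R * x.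
Proof.
elim: s => [|j s IH]; first by rewrite big_nil mul0r.
by rewrite big_cons IH -[(size (j :: s))%:R]natr1 mulrDl mul1r addrC.
Qed.

Section SumMoments.
Context d (T : measurableType d) (R : realType) (P : probability T R).
Context (X : nat -> T -> nat).
Hypothesis mX : forall j, measurable_fun setT (X j).
Hypothesis massX : forall j, mass P (X j) =1 mass P (X 0%N).
Local Notation EX := (Emean P (fun w => (X 0%N w)%:R)).
Local Notation EX2 := (Emean P (fun w => (X 0%N w)%:R ^+ 2)).

Lemma L1_ident (phi : nat -> R) j :
  L1 P (fun w => phi (X 0%N w)) -> L1 P (fun w => phi (X j w)).
Proof. by apply: L1_mass_eq => // k; rewrite massX. Qed.

Lemma Emean_ident (phi : nat -> R) j : L1 P (fun w => phi (X 0%N w)) ->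
  Emean P (fun w => phi (X j w)) = Emean P (fun w => phi (X 0%N w)).
Proof.
move=> i0; apply/esym; apply: (Emean_mass_eq _ _ _ i0) => // k.
by rewrite massX.
Qed.

Lemma natr_partial_sum s w :
  (partial_sum X s w)%:R = \sum_(j <- s) (X j w)%:R :> R.
Proof. by rewrite /partial_sum natr_sum. Qed.

Hypothesis iX : L1 P (fun w => (X 0%N w)%:R).

Lemma L1_partial_sum s : L1 P (fun w => (partial_sum X s w)%:R).
Proof.
under eq_fun do rewrite natr_partial_sum.
by apply: L1_sum => j; exact: (L1_ident (phi := fun k => k%:R)).
Qed.

Lemma Emean_partial_sum s :
  Emean P (fun w => (partial_sum X s w)%:R) = (size s)%:R * EX.
Proof.
under eq_fun do rewrite natr_partial_sum.
rewrite Emean_sum; last by move=> j; exact: (L1_ident (phi := fun k => k%:R)).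
under eq_bigr do rewrite (Emean_ident (phi := fun k => k%:R))//.
by rewrite sum_const_seq.
Qed.

Lemma Emean_partial_sum_dist s :
  Emean P (fun w => `|(partial_sum X s w)%:R - (size s)%:R|) <=
  (size s)%:R * Emean P (fun w => `|(X 0%N w)%:R - 1|).
Proof.
have i1 j : L1 P (fun w => `|(X j w)%:R - 1|).
  apply: (L1_ident (phi := fun k => `|k%:R - 1|)).
  by apply/L1_norm/L1B => //; exact: L1_cst.
have -> : (size s)%:R * Emean P (fun w => `|(X 0%N w)%:R - 1|) =
    Emean P (fun w => \sum_(j <- s) `|(X j w)%:R - 1|).
  rewrite Emean_sum//.
  under eq_bigr do rewrite (Emean_ident (phi := fun k => `|k%:R - 1|))//.
  by rewrite sum_const_seq.
apply: Emean_le.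
- by apply/L1_norm/L1B; [exact: L1_partial_sum|exact: L1_cst].
- exact: L1_sum.
- move=> w; rewrite natr_partial_sum.
  have -> : (size s)%:R = \sum_(j <- s) 1 :> R by rewrite sum_const_seq mulr1.
  by rewrite -sumrB; exact: ler_norm_sum.
Qed.

Hypothesis indepX : mutually_independent P X.
Hypothesis iX2 : L1 P (fun w => (X 0%N w)%:R ^+ 2).

(** Size-biasing an independent sum only size-biases one of its summands. *)
Lemma Emean_partial_sum_stein (f : nat -> R) (c : R) n :
  (forall i j, `|f i - f j| <= c * `|i%:R - j%:R|) ->
  `|Emean P (fun w =>
      (partial_sum X (iota 0 n) w)%:R * f (partial_sum X (iota 0 n) w)) -
    EX * (n%:R * Emean P (fun w => f (partial_sum X (iota 0 n.-1) w).+1))|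
  <= c * (n%:R * (EX2 - EX)).
Proof.
move=> f_lip; pose s := iota 0 n; have us : uniq s by exact: iota_uniq.
have iX2j j : L1 P (fun w => (X j w)%:R ^+ 2).
  exact: (L1_ident (phi := fun k => k%:R ^+ 2)).
have mS r : measurable_fun setT (partial_sum X r) by exact: measurable_partial_sum.
have mS1 r : measurable_fun setT (fun w => (partial_sum X r w).+1).
  exact: (measurableT_comp (f := succn)).
have remE j : j \in s ->
    forall w, partial_sum X s w = (X j w + partial_sum X (rem j s) w)%N.
  by move=> js w; rewrite /partial_sum (big_rem j).
have ind j : j \in s -> indep P (X j) (partial_sum X (rem j s)).
  by move=> js; apply: indep_partial_sum => //=; rewrite mem_rem_uniqF// rem_uniq.
pose term j := Emean P (fun w => (X j w)%:R * f (X j w + partial_sum X (rem j s) w)%N).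
have it j : j \in s ->
    L1 P (fun w => (X j w)%:R * f (X j w + partial_sum X (rem j s) w)%N).
  move=> js; apply: (L1_indep_stein f_lip) => //; first exact: ind.
  exact: L1_partial_sum.
have -> : Emean P (fun w => (partial_sum X s w)%:R * f (partial_sum X s w)) =
    \sum_(j <- s) term j.
  pose G j w : R :=
    if j \in s then (X j w)%:R * f (X j w + partial_sum X (rem j s) w)%N else 0.
  have iG j : L1 P (G j).
    by rewrite /G; case: (boolP (j \in s)) => js; [exact: it|exact: L1_cst].
  transitivity (Emean P (fun w => \sum_(j <- s) G j w)).
    congr Emean; apply/funext => w; rewrite natr_partial_sum mulr_suml.
    rewrite !big_seq; apply: eq_bigr => j js.
    by rewrite /G js -(remE _ js).
  rewrite Emean_sum// !big_seq; apply: eq_bigr => j js.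
  by rewrite /G js.
have -> : EX * (n%:R * Emean P (fun w => f (partial_sum X (iota 0 n.-1) w).+1)) =
    \sum_(j <- s) EX * Emean P (fun w => f (partial_sum X (iota 0 n.-1) w).+1).
  by rewrite sum_const_seq size_iota mulrCA.
rewrite -sumrB; apply: (le_trans (ler_norm_sum _ _ _)).
have -> : c * (n%:R * (EX2 - EX)) = \sum_(j <- s) c * (EX2 - EX).
  by rewrite sum_const_seq size_iota mulrCA.
rewrite !big_seq; apply: ler_sum => j js.
have := Emean_indep_stein f_lip (mX j) (mS _) (iX2j j) (ind _ js) (L1_partial_sum _).
rewrite (Emean_ident (phi := fun k => k%:R))//.
rewrite (Emean_ident (phi := fun k => k%:R ^+ 2))//.
have -> // : Emean P (fun w => f (partial_sum X (rem j s) w).+1) =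
  Emean P (fun w => f (partial_sum X (iota 0 n.-1) w).+1).
apply: (Emean_mass_eq (mS _) (mS _) _ (phi := fun k => f k.+1)).
- apply: mass_partial_sum => //; [exact: rem_uniq|exact: iota_uniq|].
  by rewrite size_rem// !size_iota.
- apply: (L1_lipschitz f_lip (mS1 _)).
  under eq_fun do rewrite -natr1.
  by apply: L1D; [exact: L1_partial_sum|exact: L1_cst].
Qed.

End SumMoments.

(** * The Stein bound for random sums of equally correlated variables *)

(** [N], its size-biased version [W], the summands [X] and their independent
    copies [X'] live on one space; the equal correlation has already been
    turned into the mixture relation between the masses of partial sums. *)
Section RandomSums.
Context d (T : measurableType d) (R : realType) (P : probability T R).
Context (N W : T -> nat) (X X' : nat -> T -> nat) (rho : R).
Hypothesis mN : measurable_fun setT N.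
Hypothesis mW : measurable_fun setT W.
Hypothesis mX : forall j, measurable_fun setT (X j).
Hypothesis mX' : forall j, measurable_fun setT (X' j).
Hypothesis massX' : forall j, mass P (X' j) =1 mass P (X' 0%N).
Hypothesis massX : forall j, mass P (X j) =1 mass P (X' 0%N).
Hypothesis indepX' : mutually_independent P X'.
Hypothesis iN2 : L1 P (fun w => (N w)%:R ^+ 2).
Hypothesis iX2 : L1 P (fun w => (X' 0%N w)%:R ^+ 2).
Hypothesis rho0 : 0 <= rho.
Hypothesis rho1 : rho <= 1.
Local Notation V n := (partial_sum X (iota 0 n)).
Local Notation S n := (partial_sum X' (iota 0 n)).
Local Notation EN := (Emean P (fun w => (N w)%:R)).
Local Notation EN2 := (Emean P (fun w => (N w)%:R ^+ 2)).
Local Notation EX := (Emean P (fun w => (X' 0%N w)%:R)).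
Local Notation EX2 := (Emean P (fun w => (X' 0%N w)%:R ^+ 2)).
Hypothesis EN0 : 0 < EN.
Hypothesis EX0 : 0 < EX.
Hypothesis mixture : forall n k, mass P (V n) k =
  rho * mass P (fun w => (n * X' 0 w)%N) k + (1 - rho) * mass P (S n) k.
Hypothesis indepNV : forall n, indep P N (V n).
Hypothesis indepWS : forall n, indep P W (S n).
Hypothesis size_bias : forall k, k%:R * mass P N k = EN * mass P W k.

Local Notation Y := (random_sum X N).
Local Notation S' := (random_sum X' (fun w => (W w).-1)).

Let mV n : measurable_fun setT (V n). Proof. exact: measurable_partial_sum. Qed.
Let mS n : measurable_fun setT (S n). Proof. exact: measurable_partial_sum. Qed.
Let iN : L1 P (fun w => (N w)%:R). Proof. exact: L1_of_square. Qed.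
Let iX' : L1 P (fun w => (X' 0%N w)%:R). Proof. exact: L1_of_square. Qed.

Let massX0 j : mass P (X j) =1 mass P (X 0%N).
Proof. by move=> k; rewrite massX -(massX 0). Qed.

Let iX : L1 P (fun w => (X 0%N w)%:R).
Proof.
apply: (L1_mass_eq _ _ _ (phi := fun k => k%:R) iX') => // k.
by rewrite massX.
Qed.

Let iV n : L1 P (fun w => (V n w)%:R).
Proof. exact: L1_partial_sum. Qed.

Let iS n : L1 P (fun w => (S n w)%:R).
Proof. exact: L1_partial_sum. Qed.

Let EX_E : Emean P (fun w => (X 0%N w)%:R) = EX.
Proof.
exact: (Emean_mass_eq (mX 0%N) (mX' 0%N) (massX 0%N) (phi := fun k => k%:R)).
Qed.

Let EV n : Emean P (fun w => (V n w)%:R) = n%:R * EX.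
Proof. by rewrite Emean_partial_sum// size_iota EX_E. Qed.

Let ES n : Emean P (fun w => (S n w)%:R) = n%:R * EX.
Proof. by rewrite Emean_partial_sum// size_iota. Qed.

Let Emean_norm_nat (U : T -> nat) :
  Emean P (fun w => `|(U w)%:R|) = Emean P (fun w => (U w)%:R).
Proof. by congr Emean; apply/funext => w; rewrite ger0_norm. Qed.

Let size_biased_mean (phi : nat -> R) : L1 P (fun w => (N w)%:R * phi (N w)) ->
  L1 P (fun w => phi (W w)) /\
  Emean P (fun w => (N w)%:R * phi (N w)) = EN * Emean P (fun w => phi (W w)).
Proof.
move=> iphi.
have iW : L1 P (fun w => EN * phi (W w)).
  apply: (L1_weighted (P1 := P) (U := N) (V := W) (a := fun k => k%:R)
    (b := fun=> EN)) => //; by move=> _; exact: ltW.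
have iW' : L1 P (fun w => phi (W w)).
  have := L1Z EN^-1 iW.
  by under eq_fun do rewrite mulKf ?lt0r_neq0//.
split=> //; rewrite -EmeanZ//.
apply: (Emean_weighted (P1 := P) (U := N) (V := W) (a := fun k => k%:R)
    (b := fun=> EN)) => //; by move=> _; exact: ltW.
Qed.

Let iW : L1 P (fun w => (W w)%:R).
Proof. exact: (size_biased_mean (phi := fun k => k%:R) iN2).1. Qed.

Lemma L1_random_sum : L1 P (fun w => (Y w)%:R).
Proof.
apply: (L1_freeze (U := N) (V := fun n => V n) (g := fun _ k => k%:R)
  (A := fun n => EX * n%:R)) => //.
- by move=> n; rewrite Emean_norm_nat EV mulrC.
- exact: L1Z.
Qed.

Lemma L1_biased_sum : L1 P (fun w => (S' w)%:R).
Proof.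
apply: (L1_freeze (U := W) (V := fun n => S n.-1) (g := fun _ k => k%:R)
  (A := fun n => EX * n%:R)) => //.
- move=> n; rewrite Emean_norm_nat ES [leLHS]mulrC ler_wpM2l ?(ltW EX0)// ler_nat.
  exact: leq_pred.
- exact: L1Z.
Qed.

Let iY := L1_random_sum.
Let iS' := L1_biased_sum.
Let mY : measurable_fun setT Y. Proof. exact: (measurable_at (h := fun n => V n)). Qed.
Let mS' : measurable_fun setT S'.
Proof. exact: (measurable_at (h := fun n => S n.-1)). Qed.

(** Given [N = n], both [Y] and [n] are sums of [n] terms, so that the deviation
    is at most n E|X_1 - 1|. *)
Lemma random_sum_deviation : Emean P (fun w => `|(Y w)%:R - (N w)%:R|) <=
  EN * Emean P (fun w => `|(X' 0%N w)%:R - 1|).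
Proof.
set e := Emean P (fun w => `|(X' 0%N w)%:R - 1|).
have e_E : Emean P (fun w => `|(X 0%N w)%:R - 1|) = e.
  apply: (Emean_mass_eq (mX 0%N) (mX' 0%N) (massX 0%N)
    (phi := fun k => `|k%:R - 1|)).
  by apply/L1_norm/L1B => //; exact: L1_cst.
have bnd n : Emean P (fun w => `|(V n w)%:R - n%:R|) <= e * n%:R.
  have := Emean_partial_sum_dist mX massX0 iX (iota 0 n).
  by rewrite size_iota e_E mulrC.
have iVn n : L1 P (fun w => `|(V n w)%:R - n%:R|).
  by apply/L1_norm/L1B => //; exact: L1_cst.
have ie : L1 P (fun w => e * (N w)%:R) by exact: L1Z.
have bnd' n : Emean P (fun w => `| `|(V n w)%:R - n%:R| |) <= e * n%:R.
  by under eq_fun do rewrite normr_id.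
have := L1_freeze_mean (U := N) (V := fun n => V n)
  (g := fun n k => `|k%:R - n%:R|) mN mV iVn bnd' ie.
have -> := Emean_freeze (U := N) (V := fun n => V n)
  (g := fun n k => `|k%:R - n%:R|) mN mV indepNV iVn bnd' ie.
move=> im; rewrite mulrC -EmeanZ//; apply: Emean_le => // w.
Qed.

Section Lipschitz.
Context (f : nat -> R) (c C : R).
Hypothesis f_lip : forall i j, `|f i - f j| <= c * `|i%:R - j%:R|.
Hypothesis f_growth : forall k, `|k%:R * f k| <= C * (1 + k%:R).

Let c0 : 0 <= c.
Proof.
have := f_lip 1 0; rewrite subr0 normr1 mulr1; exact: le_trans.
Qed.

Let u k := k%:R * f k.

Let iu d' (T' : measurableType d') (P' : probability T' R) (U : T' -> nat) :
  measurable_fun setT U -> L1 P' (fun w => (U w)%:R) ->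
  L1 P' (fun w => u (U w)) /\
  Emean P' (fun w => `|u (U w)|) <= C * (1 + Emean P' (fun w => (U w)%:R)).
Proof.
move=> mU iU; have iB : L1 P' (fun w => C * (1 + (U w)%:R)).
  by apply/L1Z/L1D => //; exact: L1_cst.
have iuU : L1 P' (fun w => u (U w)).
  by apply: (L1_le _ iB) => [|w]; [exact: measurable_fun_nat|exact: f_growth].
have -> : C * (1 + Emean P' (fun w => (U w)%:R)) =
    Emean P' (fun w => C * (1 + (U w)%:R)).
  have i1 := L1_cst P' (1 : R).
  by rewrite EmeanZ ?EmeanD ?Emean_cst//; exact: L1D.
split=> //; by apply: Emean_le => //; [exact: L1_norm|move=> w; exact: f_growth].
Qed.

Let mU1 (U : T -> nat) : measurable_fun setT U ->
  measurable_fun setT (fun w => (U w).+1).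
Proof. exact: (measurableT_comp (f := succn)). Qed.

Let iU1 (U : T -> nat) : L1 P (fun w => (U w)%:R) -> L1 P (fun w => (U w).+1%:R).
Proof.
by move=> iU; under eq_fun do rewrite -natr1; apply: L1D => //; exact: L1_cst.
Qed.

Let if1 (U : T -> nat) : measurable_fun setT U -> L1 P (fun w => (U w)%:R) ->
  L1 P (fun w => f (U w).+1).
Proof.
by move=> mU iU; exact: (L1_lipschitz f_lip (mU1 mU) (iU1 iU)).
Qed.

(* The mean of [u] at the sum of [n] variables, for the two components of the
   mixture: all variables equal, and all variables independent. *)
Let phi1 n := Emean P (fun w => u (n * X' 0%N w)%N).
Let phi2 n := Emean P (fun w => u (S n w)).
Let psi n := Emean P (fun w => f (S n.-1 w).+1).
Let M := EX2 - EX.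

Let mnX n : measurable_fun setT (fun w => (n * X' 0%N w)%N).
Proof. exact: (measurableT_comp (f := muln n)). Qed.

Let inX n : L1 P (fun w => (n * X' 0%N w)%:R).
Proof. by under eq_fun do rewrite natrM; exact: L1Z. Qed.

Let EnX n : Emean P (fun w => (n * X' 0%N w)%:R) = n%:R * EX.
Proof. by under eq_fun do rewrite natrM; rewrite EmeanZ. Qed.

Let iN_lin : L1 P (fun w => C * (1 + (N w)%:R * EX)).
Proof.
apply/L1Z/L1D; first exact: L1_cst.
by under eq_fun do rewrite mulrC; exact: L1Z.
Qed.

Let iphi1 : L1 P (fun w => phi1 (N w)).
Proof.
apply: (L1_le _ iN_lin); first exact: measurable_fun_nat.
move=> w; have [iuw] := iu (mnX (N w)) (inX (N w)); rewrite EnX.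
apply: le_trans; apply: Emean_norm_le => //; first exact: L1_measurable iuw.
exact: L1_norm.
Qed.

Let iphi2 : L1 P (fun w => phi2 (N w)).
Proof.
apply: (L1_le _ iN_lin); first exact: measurable_fun_nat.
move=> w; have [iuw] := iu (mS (N w)) (iS (N w)); rewrite ES.
apply: le_trans; apply: Emean_norm_le => //; first exact: L1_measurable iuw.
exact: L1_norm.
Qed.

Let Emean_uY : L1 P (fun w => u (Y w)) /\ Emean P (fun w => u (Y w)) =
  rho * Emean P (fun w => phi1 (N w)) + (1 - rho) * Emean P (fun w => phi2 (N w)).
Proof.
have bnd n : Emean P (fun w => `|u (V n w)|) <= C * (1 + n%:R * EX).
  by have [_] := iu (mV n) (iV n); rewrite EV.
split; first by have [] := iu mY iY.
rewrite (Emean_freeze (U := N) (V := fun n => V n) (g := fun _ k => u k)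
  mN mV indepNV (fun n => (iu (mV n) (iV n)).1) bnd iN_lin).
rewrite -!EmeanZ// -EmeanD; [|exact: L1Z|exact: L1Z].
congr Emean; apply/funext => w.
apply: (Emean_mixture (mV _) (mnX (N w)) (mS (N w)) (mixture (N w))).
- exact: (iu (mV _) (iV _)).1.
- exact: (iu (mnX _) (inX _)).1.
- exact: (iu (mS _) (iS _)).1.
Qed.

(* In the fully dependent component the sum is n X, and replacing f(n X) by f(n)
   costs c n E|X - 1| under the weight n X; size-biasing [N] does the rest. *)
Let phi1_stein : `|Emean P (fun w => phi1 (N w)) -
  EX * (EN * Emean P (fun w => f (W w)))| <= c * (EN2 * M).
Proof.
have iNf : L1 P (fun w => (N w)%:R * f (N w)) by exact: (iu mN iN).1.
have [_ <-] := size_biased_mean iNf.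
rewrite -EmeanZ//.
have -> : c * (EN2 * M) = Emean P (fun w => c * M * (N w)%:R ^+ 2).
  by rewrite EmeanZ//; ring.
apply: Emean_dist_le => //; [exact: L1Z|exact: L1Z|move=> w].
move: (N w) => n; rewrite /phi1.
have -> : EX * (n%:R * f n) = Emean P (fun w => n%:R * f n * (X' 0%N w)%:R).
  by rewrite EmeanZ// mulrC.
have -> : c * M * n%:R ^+ 2 =
    Emean P (fun w => c * n%:R ^+ 2 * ((X' 0%N w)%:R ^+ 2 - (X' 0%N w)%:R)).
  by rewrite EmeanZ ?EmeanB// /M; [ring|exact: L1B].
apply: Emean_dist_le.
- exact: (iu (mnX n) (inX n)).1.
- exact: L1Z.
- by apply/L1Z/L1B.
- move=> w'; move: (X' 0%N w') => k; rewrite /u -natr_mul_dist1.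
  have -> : (n * k)%:R * f (n * k)%N - n%:R * f n * k%:R =
    (n * k)%:R * (f (n * k)%N - f n) by rewrite natrM; ring.
  rewrite normrM ger0_norm//.
  apply: (le_trans (ler_wpM2l (ler0n _ _) (f_lip _ _))).
  rewrite natrM -[X in _ - X]mulr1 -mulrBr normrM ger0_norm//.
  by rewrite le_eqVlt; apply/orP; left; apply/eqP; ring.
Qed.

Let ipsi : L1 P (fun w => (N w)%:R * psi (N w)).
Proof.
apply: (L1_le (G := fun w => (`|f 0%N| + c) * (N w)%:R + c * EX * (N w)%:R ^+ 2)).
- exact: (measurable_fun_nat (fun n => n%:R * psi n)).
- by apply: L1D; exact: L1Z.
- move=> w; move: (N w) => n; rewrite normrM ger0_norm//.
  have H : `|psi n| <= `|f 0%N| + c + c * EX * n%:R.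
    apply: (@le_trans _ _ (Emean P (fun w => `|f 0%N| + c * (S n.-1 w).+1%:R))).
      apply: Emean_norm_le.
      + exact: (measurable_fun_nat (fun k => f k.+1)).
      + by apply: L1D; [exact: L1_cst|apply/L1Z/iU1].
      + by move=> w'; exact: lipschitz_growth.
    rewrite EmeanD; [|exact: L1_cst|exact/L1Z/iU1].
    rewrite Emean_cst EmeanZ; last exact: iU1.
    under eq_fun do rewrite -natr1.
    rewrite EmeanD//; last exact: L1_cst.
    rewrite Emean_cst ES.
    have H : n.-1%:R * EX <= n%:R * EX.
      by rewrite ler_wpM2r ?(ltW EX0)// ler_nat leq_pred.
    by have := ler_wpM2l c0 H; lra.
  by apply: (le_trans (ler_wpM2l (ler0n _ n) H)); lra.
Qed.

(* In the independent component, size-biasing one summand and [N] turns the sum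
   into [S' + 1], up to the error of the size-biased summand. *)
Let phi2_stein : `|Emean P (fun w => phi2 (N w)) -
  EX * (EN * Emean P (fun w => f (S' w).+1))| <= c * (EN * M).
Proof.
have [ipW E] := size_biased_mean ipsi.
have -> : Emean P (fun w => f (S' w).+1) = Emean P (fun w => psi (W w)).
  apply: (Emean_freeze (U := W) (V := fun n => S n.-1) (g := fun _ k => f k.+1)
    (A := fun n => `|f 0%N| + c * (1 + n%:R * EX))) => //.
  - by move=> n; exact: if1.
  - move=> n.
    apply: (@le_trans _ _ (Emean P (fun w => `|f 0%N| + c * (S n.-1 w).+1%:R))).
      apply: Emean_le.
      + exact/L1_norm/if1.
      + by apply: L1D; [exact: L1_cst|apply/L1Z/iU1].
      + by move=> w'; exact: lipschitz_growth.
    rewrite EmeanD; [|exact: L1_cst|exact/L1Z/iU1].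
    rewrite Emean_cst EmeanZ; last exact: iU1.
    under eq_fun do rewrite -natr1.
    rewrite EmeanD//; last exact: L1_cst.
    rewrite Emean_cst ES lerD2l ler_wpM2l// addrC lerD2l.
    by rewrite ler_wpM2r ?(ltW EX0)// ler_nat leq_pred.
  - apply: L1D; first exact: L1_cst.
    apply/L1Z/L1D; first exact: L1_cst.
    by under eq_fun do rewrite mulrC; exact: L1Z.
rewrite -E -EmeanZ//.
have -> : c * (EN * M) = Emean P (fun w => c * M * (N w)%:R).
  by rewrite EmeanZ//; ring.
apply: Emean_dist_le => //; [exact: L1Z|exact: L1Z|move=> w].
have := Emean_partial_sum_stein mX' massX' iX' indepX' iX2 (N w) f_lip.
by rewrite [X in _ <= X -> _](_ : _ = c * M * (N w)%:R)//; rewrite /M; ring.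
Qed.

Let lam := EN * EX.
Let D1 := Emean P (fun w => `|(N w)%:R + 1 - (W w)%:R|).
Let D2 := Emean P (fun w => `|(X' 0%N w)%:R - 1|).
Let D3 := Emean P (fun w => `|(Y w)%:R - (S' w)%:R|).

(** Splitting [Y f(Y)] according to the mixture but keeping [f(Y + 1)] whole, and
    comparing the same [Y + 1] with [W] in one component and with [S' + 1] in the
    other: the sum [Y] of correlated variables then appears in the coupling of
    the independent component. *)
Lemma random_sum_stein :
  L1 P (fun w => f (Y w).+1) /\ L1 P (fun w => (Y w)%:R * f (Y w)) /\
  `|lam * Emean P (fun w => f (Y w).+1) - Emean P (fun w => (Y w)%:R * f (Y w))|
  <= c * lam * (rho * (D1 + EN * D2 + EN2 / EN * (EX2 / EX - 1)) +
               (1 - rho) * (EX2 / EX - 1 + D3)).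
Proof.
have ifY := if1 mY iY; have [iuY EuY] := Emean_uY.
split=> //; split=> //; rewrite EuY.
have iYN : L1 P (fun w => `|(Y w)%:R - (N w)%:R|) by exact/L1_norm/L1B.
have iNW : L1 P (fun w => `|(N w)%:R + 1 - (W w)%:R|).
  by apply/L1_norm/L1B => //; apply: L1D => //; exact: L1_cst.
have d1 : `|Emean P (fun w => f (Y w).+1) - Emean P (fun w => f (W w))| <=
    c * (D1 + EN * D2).
  apply: (@le_trans _ _ (c * (D1 + Emean P (fun w => `|(Y w)%:R - (N w)%:R|)))).
    rewrite -EmeanD// -EmeanZ; last exact: L1D.
    apply: Emean_dist_le => //; first exact: (L1_lipschitz f_lip).
      by apply/L1Z/L1D.
    move=> w; apply: (le_trans (f_lip _ _)); rewrite ler_wpM2l//.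
    have -> : (Y w).+1%:R - (W w)%:R =
      ((N w)%:R + 1 - (W w)%:R) + ((Y w)%:R - (N w)%:R) :> R by rewrite -natr1; ring.
    exact: ler_normD.
  by rewrite ler_wpM2l// lerD2l; exact: random_sum_deviation.
have d3 : `|Emean P (fun w => f (Y w).+1) - Emean P (fun w => f (S' w).+1)| <=
    c * D3.
  rewrite -EmeanZ; last by apply/L1_norm/L1B.
  apply: Emean_dist_le => //; first exact: if1.
    by apply/L1Z/L1_norm/L1B.
  move=> w; apply: (le_trans (f_lip _ _)).
  by rewrite -!natr1 opprD addrACA subrr addr0.
have EXn0 : EX != 0 by exact: lt0r_neq0.
have ENn0 : EN != 0 by exact: lt0r_neq0.
have lam0 : 0 <= lam by rewrite mulr_ge0// ltW.
move: phi1_stein phi2_stein d1 d3.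
set e1 := Emean P (fun w => phi1 _); set e2 := Emean P (fun w => phi2 _).
set fY := Emean P (fun w => f (Y w).+1); set fW := Emean P (fun w => f (W w)).
set fS := Emean P (fun w => f (S' w).+1) => p1 p2 d1 d3.
have -> : lam * fY - (rho * e1 + (1 - rho) * e2) =
  rho * (lam * (fY - fW) - (e1 - EX * (EN * fW))) +
  (1 - rho) * (lam * (fY - fS) - (e2 - EX * (EN * fS))) by rewrite /lam; ring.
have -> : c * lam * (rho * (D1 + EN * D2 + EN2 / EN * (EX2 / EX - 1)) +
    (1 - rho) * (EX2 / EX - 1 + D3)) =
  rho * (lam * (c * (D1 + EN * D2)) + c * (EN2 * M)) +
  (1 - rho) * (lam * (c * D3) + c * (EN * M)).
  by rewrite /lam /M; field; rewrite EXn0 ENn0.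
have rho1' : 0 <= 1 - rho by rewrite subr_ge0.
apply: (le_trans (ler_normD _ _)); rewrite !normrM (ger0_norm rho0) (ger0_norm rho1').
have tri x y a b : `|x| <= a -> `|y| <= b -> `|lam * x - y| <= lam * a + b.
  move=> xa yb; apply: (le_trans (ler_normB _ _)).
  by rewrite normrM (ger0_norm lam0) lerD// ler_wpM2l.
by apply: lerD; rewrite ler_wpM2l//; exact: tri.
Qed.

End Lipschitz.
End RandomSums.

(** * Laws of the variables of the theorem *)

Section Laws.
Context (R : realType).

Lemma mass_same_law d1 (T1 : measurableType d1) d2 (T2 : measurableType d2)
    (P1 : probability T1 R) (P2 : probability T2 R)
    (U : T1 -> nat) (V : T2 -> nat) :
  measurable_fun setT U -> measurable_fun setT V ->
  same_law P1 P2 U V -> mass P1 U =1 mass P2 V.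
Proof.
move=> mU mV UV k; apply: EFin_inj; rewrite -!massE//.
exact: UV.
Qed.

Lemma same_law_comp d1 (T1 : measurableType d1) d2 (T2 : measurableType d2)
    d (S : measurableType d) d' (S' : measurableType d')
    (P1 : probability T1 R) (P2 : probability T2 R)
    (U : T1 -> S) (V : T2 -> S) (phi : S -> S') :
  measurable_fun setT phi -> same_law P1 P2 U V ->
  same_law P1 P2 (phi \o U) (phi \o V).
Proof.
move=> mphi UV A mA; apply: (UV (phi @^-1` A)).
by rewrite -[X in measurable X]setTI; exact: mphi.
Qed.

Lemma same_law_tnth d1 (T1 : measurableType d1) d2 (T2 : measurableType d2)
    (P1 : probability T1 R) (P2 : probability T2 R) n
    (U : 'I_n -> T1 -> nat) (V : 'I_n -> T2 -> nat) (i : 'I_n) :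
  same_law P1 P2 (fun w => [tuple U i w | i < n]) (fun w => [tuple V i w | i < n]) ->
  same_law P1 P2 (U i) (V i).
Proof.
move=> /(same_law_comp (measurable_tnth i)).
by rewrite /comp; under eq_fun do rewrite tnth_mktuple;
  under [X in same_law _ _ _ X]eq_fun do rewrite tnth_mktuple.
Qed.

Lemma exchangeable_same_law d (T : measurableType d) (P : probability T R)
    (X : nat -> T -> nat) k : exchangeable P X -> same_law P P (X k) (X 0%N).
Proof.
move=> /(_ k.+1 (tperm ord0 ord_max))/(@same_law_tnth _ _ _ _ _ _ _ _ _ ord0).
by rewrite tpermL.
Qed.

Lemma same_law_partial_sum d1 (T1 : measurableType d1)
    d2 (T2 : measurableType d2)
    (P1 : probability T1 R) (P2 : probability T2 R)
    (X : nat -> T1 -> nat) (Y : nat -> T2 -> nat) n : same_law_seq P1 P2 X Y ->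
  same_law P1 P2 (partial_sum X (iota 0 n)) (partial_sum Y (iota 0 n)).
Proof.
have mphi : measurable_fun setT (fun t : n.-tuple nat => \sum_(i < n) tnth t i)%N.
  by apply: measurable_sumn => i; exact: measurable_tnth.
have E (T : Type) (Z : nat -> T -> nat) : partial_sum Z (iota 0 n) =
    (fun t : n.-tuple nat => \sum_(i < n) tnth t i)%N \o
    (fun w => [tuple Z i w | i < n]).
  apply/funext => w; rewrite partial_sum_iota /comp.
  by under [RHS]eq_bigr do rewrite tnth_mktuple.
by move=> /(_ n)/(same_law_comp mphi); rewrite -!E.
Qed.

Lemma indep_setI d (T : measurableType d) (P : probability T R)
    (U V : T -> nat) : measurable_fun setT U -> measurable_fun setT V ->
  (forall i k, P (U @^-1` [set i] `&` V @^-1` [set k]) =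
    (P (U @^-1` [set i]) * P (V @^-1` [set k]))%E) -> indep P U V.
Proof.
move=> mU mV UV i k; apply: EFin_inj; rewrite EFinM -!massE// -UV.
have mUi : measurable (U @^-1` [set i]).
  by rewrite -[X in measurable X]setTI; exact: mU.
have mVk : measurable (V @^-1` [set k]).
  by rewrite -[X in measurable X]setTI; exact: mV.
have mI := measurableI _ _ mUi mVk.
rewrite -(expectation_indic P mI) expectation_L1; last exact: integrable_indic.
congr (Emean _ _)%:E; apply/funext => w; rewrite indicE in_setI -mulnb natrM.
have E (Z : T -> nat) j : (w \in Z @^-1` [set j]) = (Z w == j).
  have [<-|/eqP Zj] := eqVneq (Z w) j; first by rewrite mem_set.
  by rewrite memNset.
by rewrite !E.
Qed.

Lemma sigma_seq_partial_sum d (T : measurableType d)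
    d' (S : measurableType d') (X : nat -> T -> S) (phi : S -> nat) s k :
  measurable_fun setT phi ->
  sigma_seq X (partial_sum (fun j w => phi (X j w)) s @^-1` [set k]).
Proof.
move=> mphi.
set G := \bigcup_k preimage_set_system setT (X k) measurable.
have mX j : measurable_fun setT ((fun w => phi (X j w)) : g_sigma_algebraType G -> nat).
  move=> _ B mB; apply: sub_gen_smallest; exists j => //.
  exists (phi @^-1` B) => //.
  by rewrite -[X in measurable X]setTI; exact: mphi.
have := measurable_partial_sum mX s.
by move=> /(_ measurableT [set k] I); rewrite setTI.
Qed.

Lemma indep_of_seq d (T : measurableType d) (P : probability T R)
    d1 (S1 : measurableType d1) d2 (S2 : measurableType d2)
    (W : T -> S1) (X : nat -> T -> S2) (pi : S1 -> nat) (phi : S2 -> nat) s :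
  measurable_fun setT (pi \o W) ->
  (forall j, measurable_fun setT (fun w => phi (X j w))) ->
  measurable_fun setT pi -> measurable_fun setT phi ->
  independent_of_seq P W X ->
  indep P (pi \o W) (partial_sum (fun j w => phi (X j w)) s).
Proof.
move=> mW mX mpi mphi WX; apply: indep_setI => //.
  exact: measurable_partial_sum.
move=> i k; apply: (WX (pi @^-1` [set i])).
  by rewrite -[X in measurable X]setTI; exact: mpi.
exact: sigma_seq_partial_sum.
Qed.

Lemma size_biased_mass d (T : measurableType d) d' (T' : measurableType d')
    (P : probability T R) (P' : probability T' R)
    (N : T -> nat) (W : T' -> nat) k :
  measurable_fun setT N -> measurable_fun setT W ->
  Emean P (fun w => (N w)%:R) != 0 ->
  size_biased P P' (fun w => (N w)%:R) (fun w => (W w)%:R) ->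
  k%:R * mass P N k = Emean P (fun w => (N w)%:R) * mass P' W k.
Proof.
move=> mN mW EN0 sb; pose g : R -> R := \1_[set k%:R].
have gE (n : nat) : g n%:R = (n == k)%:R.
  rewrite /g indicE; have [->|nk] := eqVneq n k; first by rewrite mem_set.
  by rewrite memNset//= => /eqP; rewrite eqr_nat (negbTE nk).
have mg : measurable_fun setT g by exact: measurable_indic.
have NgE : (fun w => (N w)%:R * g (N w)%:R) = (fun w => k%:R * (N w == k)%:R).
  by apply/funext => w; rewrite gE; case: eqP => [->|]; rewrite ?mulr0.
have ig : L1 P (fun w => (N w)%:R * g (N w)%:R).
  by rewrite NgE; apply: L1Z; exact: L1_mass.
have := sb g mg ig; rewrite NgE.
rewrite EmeanZ; last exact: L1_mass.
have -> : g \o (fun w => (W w)%:R) = fun w => (W w == k)%:R.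
  by apply/funext => w /=; rewrite gE.
rewrite expectation_L1; last exact: L1_mass.
by rewrite -/(mass P' W k) -/(mass P N k) => -[->]; rewrite [RHS]mulrC divfK.
Qed.

(** Along constant frequencies the model says that X_1 + ... + X_n is a
    mixture of n X_1 and of an independent sum. *)
Lemma mass_equally_correlated d (T : measurableType d) d' (T' : measurableType d')
    (P : probability T R) (P' : probability T' R) (rho : R)
    (X : nat -> T -> nat) (X' : nat -> T' -> nat) n k :
  (forall j, measurable_fun setT (X j)) ->
  (forall j, measurable_fun setT (X' j)) ->
  (forall j, mass P (X j) =1 mass P' (X' j)) ->
  mutually_independent P' X' ->
  equally_correlated P rho (fun k w => (X k w)%:R) ->
  mass P (partial_sum X (iota 0 n)) k =
    rho * mass P (fun w => (n * X 0 w)%N) k +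
    (1 - rho) * mass P' (partial_sum X' (iota 0 n)) k.
Proof.
move=> mX mX' XX' indX' corr.
have mnX : measurable_fun setT (fun w => (n * X 0 w)%N).
  exact: (measurableT_comp (f := muln n)).
have [n0|n0] := posnP n.
  rewrite n0 /mass /partial_sum/=.
  under [in LHS]eq_fun do rewrite big_nil.
  under [in X in _ = _ + X]eq_fun do rewrite big_nil.
  by rewrite !Emean_cst; ring.
apply: charf_mixture => //; [exact: measurable_partial_sum| |move=> t].
  exact: measurable_partial_sum.
have := corr n (fun=> t) n0.
have -> : Cmean P (fun w => expi (\sum_(j < n) t * (X j w)%:R)) =
    charf P (partial_sum X (iota 0 n)) t.
  congr Cmean; apply/funext => w.
  by rewrite partial_sum_iota natr_sum mulr_sumr.
have -> : Cmean P (fun w => expi ((X 0%N w)%:R * \sum_(j < n) t)) =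
    charf P (fun w => (n * X 0 w)%N) t.
  congr Cmean; apply/funext => w; congr expi.
  by rewrite sumr_const card_ord -mulr_natl natrM; ring.
move=> ->; congr (_ + _ * _).
rewrite (charf_partial_sum mX' indX')//; last exact: iota_uniq.
have -> : iota 0 n = index_iota 0 n by rewrite /index_iota subn0.
rewrite big_mkord; apply: eq_bigr => j _.
exact: charf_mass.
Qed.

Lemma mass_random_sum d (T : measurableType d) d' (T' : measurableType d')
    (P : probability T R) (P' : probability T' R)
    (N : T -> nat) (N' : T' -> nat) (V : nat -> T -> nat) (V' : nat -> T' -> nat) :
  measurable_fun setT N -> measurable_fun setT N' ->
  (forall n, measurable_fun setT (V n)) ->
  (forall n, measurable_fun setT (V' n)) ->
  mass P N =1 mass P' N' -> (forall n, mass P (V n) =1 mass P' (V' n)) ->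
  (forall n, indep P N (V n)) -> (forall n, indep P' N' (V' n)) ->
  mass P (fun w => V (N w) w) =1 mass P' (fun w => V' (N' w) w).
Proof.
move=> mN mN' mV mV' NN VV indN indN' k.
have frz d0 (T0 : measurableType d0) (P0 : probability T0 R) (N0 : T0 -> nat)
    (V0 : nat -> T0 -> nat) : measurable_fun setT N0 ->
    (forall n, measurable_fun setT (V0 n)) -> (forall n, indep P0 N0 (V0 n)) ->
    L1 P0 (fun w => mass P0 (V0 (N0 w)) k) /\
    mass P0 (fun w => V0 (N0 w) w) k = Emean P0 (fun w => mass P0 (V0 (N0 w)) k).
  move=> mN0 mV0 ind0.
  have ig n : L1 P0 (fun w => (V0 n w == k)%:R) by exact: L1_mass.
  have bnd n : Emean P0 (fun w => `|(V0 n w == k)%:R : R|) <= 1.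
    rewrite -[leRHS](Emean_cst P0); apply: Emean_le.
    - exact: L1_norm.
    - exact: L1_cst.
    - by move=> w; case: (_ == _); rewrite ?normr1 ?normr0.
  have i1 : L1 P0 (fun w => (fun=> 1) (N0 w)) by exact: L1_cst.
  split.
    exact: (L1_freeze_mean (g := fun _ j => (j == k)%:R) mN0 mV0 ig bnd i1).
  exact: (Emean_freeze (g := fun _ j => (j == k)%:R) mN0 mV0 ind0 ig bnd i1).
have [i1 ->] := frz _ _ P N V mN mV indN.
have [_ ->] := frz _ _ P' N' V' mN' mV' indN'.
rewrite (Emean_mass_eq mN mN' NN (phi := fun n => mass P (V n) k) i1).
by congr Emean; apply/funext => w; rewrite VV.
Qed.

Lemma L1_square_of_cube d (T : measurableType d) (P : probability T R)
    (U : T -> nat) : measurable_fun setT U ->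
  ('E_P[(fun w => (U w)%:R ^+ 3)%R] < +oo)%E -> L1 P (fun w => (U w)%:R ^+ 2).
Proof.
move=> mU U3; have i3 : L1 P (fun w => (U w)%:R ^+ 3).
  apply: L1_ge0 => //; exact: (measurable_fun_nat (fun k => k%:R ^+ 3)).
apply: (L1_le _ i3); first exact: (measurable_fun_nat (fun k => k%:R ^+ 2)).
move=> w; rewrite ger0_norm ?exprn_ge0// -!natrX ler_nat.
by case: (U w) => // k; rewrite leq_pexp2l.
Qed.

Lemma poisson_mass_recurrence d (T : measurableType d) (Q : probability T R)
    (Z : T -> nat) (lam : R) : measurable_fun setT Z -> 0 < lam ->
  (forall j, Q (Z @^-1` [set j]) = (poisson_pmf lam j)%:E) ->
  (forall k, 0 < mass Q Z k) /\
  (forall k, k.+1%:R * mass Q Z k.+1 = lam * mass Q Z k).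
Proof.
move=> mZ lam0 Zlaw.
have E k : mass Q Z k = lam ^+ k * k`!%:R^-1 * expR (- lam).
  by apply: EFin_inj; rewrite -massE// Zlaw /poisson_pmf lam0.
split=> k; rewrite !E.
  by rewrite !mulr_gt0 ?expR_gt0 ?invr_gt0 ?exprn_gt0// ltr0n fact_gt0.
have gen (a b x e : R) : a != 0 -> b != 0 ->
    a * (lam * x * (a * b)^-1 * e) = lam * (x * b^-1 * e).
  by move=> a0 b0; field; rewrite a0 b0.
by rewrite factS natrM exprS gen// pnatr_eq0 -lt0n fact_gt0.
Qed.

End Laws.

(** * The Wasserstein bound *)

(** The Stein equation itself shows that [k f k] grows linearly, so that first
    moments of the sum suffice. *)
Lemma stein_growth (R : realType) (f h : nat -> R) (lam c e : R) : 0 <= lam ->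
  (forall k, lam * f k.+1 - k%:R * f k = h k - e) ->
  (forall i j, `|f i - f j| <= c * `|i%:R - j%:R|) ->
  (forall i j, `|h i - h j| <= `|i%:R - j%:R|) ->
  exists C, forall k, `|k%:R * f k| <= C * (1 + k%:R).
Proof.
move=> lam0 fE f_lip h_lip.
exists (lam * (`|f 0%N| + c) + `|h 0%N| + `|e| + lam * c + 1) => k.
have -> : k%:R * f k = lam * f k.+1 - (h k - e) by rewrite -fE; ring.
have c0 : 0 <= c.
  have := f_lip 1%N 0%N; rewrite subr0 normr1 mulr1; exact: le_trans.
have h_lip1 i j : `|h i - h j| <= 1 * `|i%:R - j%:R| by rewrite mul1r.
have hk := lipschitz_growth h_lip1 k.
have fk := ler_wpM2l lam0 (lipschitz_growth f_lip k.+1).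
apply: (le_trans (ler_normB _ _)); rewrite normrM (ger0_norm lam0).
have he := ler_normB (h k) e; rewrite -[k.+1%:R]natr1 in fk.
have k0 : (0 : R) <= k%:R by exact: ler0n.
have p0 : 0 <= lam * c by rewrite mulr_ge0.
have p1 : 0 <= lam * c * k%:R by rewrite !mulr_ge0.
have p2 : 0 <= lam * `|f 0%N| * k%:R by rewrite !mulr_ge0.
have p3 : 0 <= `|h 0%N| * k%:R by rewrite !mulr_ge0.
have p4 : 0 <= `|e| * k%:R by rewrite !mulr_ge0.
lra.
Qed.

(* X k stands for X_{k+1} and X' k for X'_{k+1}.  Y and Z live on arbitrary spaces
   (T, P) and (T'', Q).  The coupling is any space (T', P') carrying copies Nc of N
   and Xc of (X_k)_k, the size-biased Ns, and the X'_j; since Ns >= 1 almost surely,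
   the truncated predecessor below is N^s - 1. *)
Theorem theorem4p1 (R : realType)
  (d : measure_display) (T : measurableType d) (P : probability T R)
  (N : {RV P >-> nat}) (X : nat -> {RV P >-> nat}) (rho : R)
  (d' : measure_display) (T' : measurableType d') (P' : probability T' R)
  (Nc Ns : {RV P' >-> nat}) (Xc X' : nat -> {RV P' >-> nat})
  (d'' : measure_display) (T'' : measurableType d'') (Q : probability T'' R)
  (Z : {RV Q >-> nat})
  (N_mean_gt0 : (0 < 'E_P[(fun w => (N w)%:R)%R])%E)
  (N_moment3 : ('E_P[(fun w => (N w)%:R ^+ 3)%R] < +oo)%E)
  (X_exch : exchangeable P (fun k w => X k w))
  (N_indep_X : independent_of_seq P N (fun k w => X k w))
  (X_mean_gt0 : (0 < 'E_P[(fun w => (X 0%N w)%:R)%R])%E)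
  (X_moment3 : ('E_P[(fun w => (X 0%N w)%:R ^+ 3)%R] < +oo)%E)
  (rho_ge0 : 0 <= rho) (rho_le1 : rho <= 1)
  (X_corr : equally_correlated P rho (fun k w => (X k w)%:R))
  (Z_law : forall j : nat, Q (Z @^-1` [set j]) =
    (poisson_pmf (Emean P (fun w => (N w)%:R) *
                  Emean P (fun w => (X 0%N w)%:R)) j)%:E)
  (Nc_law : same_law P' P Nc N)
  (Ns_law : size_biased P P' (fun w => (N w)%:R) (fun w => (Ns w)%:R))
  (Xc_law : same_law_seq P' P (fun k w => Xc k w) (fun k w => X k w))
  (X'_law : forall k : nat, same_law P' P (X' k) (X 0%N))
  (X'_indep : mutually_independent P' (fun k w => X' k w))
  (pair_indep : independent_of_seq P' (fun w => (Nc w, Ns w))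
                                      (fun k w => (Xc k w, X' k w))) :
  let EN := Emean P (fun w => (N w)%:R) in
  let EN2 := Emean P (fun w => (N w)%:R ^+ 2) in
  let EX := Emean P (fun w => (X 0%N w)%:R) in
  let EX2 := Emean P (fun w => (X 0%N w)%:R ^+ 2) in
  let Y := fun w => \sum_(k < N w) (X k w)%:R in
  (dW P Q Y (fun w => (Z w)%:R)%R <=
    (3 * rho * Num.sqrt (EN * EX) *
       (Emean P' (fun w => `|(Nc w)%:R + 1 - (Ns w)%:R|)
        + EN * Emean P (fun w => `|(X 0%N w)%:R - 1|)
        + EN2 / EN * (EX2 / EX - 1))
     + 3 * (1 - rho) * Num.sqrt (EN * EX) *
       (EX2 / EX - 1
        + Emean P' (fun w => `|\sum_(k < Nc w) (Xc k w)%:R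
                               - \sum_(j < (Ns w).-1) (X' j w)%:R|)))%:E)%E.
Proof.
cbv zeta.
set EN := Emean P (fun w => (N w)%:R); set EN2 := Emean P (fun w => (N w)%:R ^+ 2).
set EX := Emean P (fun w => (X 0%N w)%:R).
set EX2 := Emean P (fun w => (X 0%N w)%:R ^+ 2).
set Y := fun w => \sum_(k < N w) (X k w)%:R.
have mN : measurable_fun setT N by exact: measurable_funPT.
have mX j : measurable_fun setT (X j) by exact: measurable_funPT.
have mNc : measurable_fun setT Nc by exact: measurable_funPT.
have mNs : measurable_fun setT Ns by exact: measurable_funPT.
have mXc j : measurable_fun setT (Xc j) by exact: measurable_funPT.
have mX' j : measurable_fun setT (X' j) by exact: measurable_funPT.
have mZ : measurable_fun setT Z by exact: measurable_funPT.
have mV n : measurable_fun setT (partial_sum X (iota 0 n)).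
  exact: measurable_partial_sum.
have mVc n : measurable_fun setT (partial_sum Xc (iota 0 n)).
  exact: measurable_partial_sum.
have NcN : mass P' Nc =1 mass P N by exact: mass_same_law.
have NNc k : mass P N k = mass P' Nc k by rewrite NcN.
have XX0 j : mass P (X j) =1 mass P (X 0%N).
  by apply: mass_same_law => //; exact: (exchangeable_same_law j X_exch).
have X'X0 j : mass P' (X' j) =1 mass P (X 0%N) by exact: mass_same_law.
have XcX0 j : mass P' (Xc j) =1 mass P (X 0%N).
  move=> k; rewrite -(XX0 j); apply: mass_same_law => //.
  exact: (same_law_tnth ord_max (Xc_law j.+1)).
have VcV n : mass P (partial_sum X (iota 0 n)) =1
    mass P' (partial_sum Xc (iota 0 n)).
  by move=> k; apply/esym; apply: mass_same_law => //; exact: same_law_partial_sum.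
have iN2 : L1 P (fun w => (N w)%:R ^+ 2) by exact: L1_square_of_cube.
have iX2 : L1 P (fun w => (X 0%N w)%:R ^+ 2) by exact: L1_square_of_cube.
have iN : L1 P (fun w => (N w)%:R) by exact: L1_of_square.
have iX : L1 P (fun w => (X 0%N w)%:R) by exact: L1_of_square.
have EN0 : 0 < EN by rewrite -lte_fin -expectation_L1.
have EX0 : 0 < EX by rewrite -lte_fin -expectation_L1.
have XX'0 k : mass P (X 0%N) k = mass P' (X' 0%N) k by rewrite X'X0.
have trN (phi : nat -> R) := Emean_mass_eq mN mNc NNc (phi := phi).
have trX (phi : nat -> R) := Emean_mass_eq (mX 0%N) (mX' 0%N) XX'0 (phi := phi).
have iNc2 : L1 P' (fun w => (Nc w)%:R ^+ 2).
  exact: (L1_mass_eq mN mNc NNc (phi := fun k => k%:R ^+ 2)).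
have iX'2 : L1 P' (fun w => (X' 0%N w)%:R ^+ 2).
  exact: (L1_mass_eq (mX 0%N) (mX' 0%N) XX'0 (phi := fun k => k%:R ^+ 2)).
have ENc : EN = Emean P' (fun w => (Nc w)%:R) by exact: (trN (fun k => k%:R)).
have ENc2 : EN2 = Emean P' (fun w => (Nc w)%:R ^+ 2).
  exact: (trN (fun k => k%:R ^+ 2)).
have EX' : EX = Emean P' (fun w => (X' 0%N w)%:R) by exact: (trX (fun k => k%:R)).
have EX'2 : EX2 = Emean P' (fun w => (X' 0%N w)%:R ^+ 2).
  exact: (trX (fun k => k%:R ^+ 2)).
have EXd : Emean P (fun w => `|(X 0%N w)%:R - 1|) =
    Emean P' (fun w => `|(X' 0%N w)%:R - 1|).
  apply: (trX (fun k => `|k%:R - 1|)).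
  by apply/L1_norm/L1B => //; exact: L1_cst.
have indNV n : indep P N (partial_sum X (iota 0 n)).
  exact: (indep_of_seq (pi := id) (phi := id) _ mN mX _ _ N_indep_X).
have indNcVc n : indep P' Nc (partial_sum Xc (iota 0 n)).
  have := @indep_of_seq _ _ _ P' _ _ _ _ (fun w => (Nc w, Ns w))
    (fun j w => (Xc j w, X' j w)) fst fst (iota 0 n).
  exact.
have indNsS n : indep P' Ns (partial_sum X' (iota 0 n)).
  have := @indep_of_seq _ _ _ P' _ _ _ _ (fun w => (Nc w, Ns w))
    (fun j w => (Xc j w, X' j w)) snd snd (iota 0 n).
  exact.
have mixture n k : mass P' (partial_sum Xc (iota 0 n)) k =
    rho * mass P' (fun w => (n * X' 0 w)%N) k +
    (1 - rho) * mass P' (partial_sum X' (iota 0 n)) k.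
  rewrite -VcV (mass_equally_correlated n k mX mX' _ X'_indep X_corr); last first.
    by move=> j l; rewrite XX0 X'X0.
  congr (_ * _ + _); rewrite /mass.
  apply: (Emean_mass_eq (mX 0%N) (mX' 0%N) XX'0 (phi := fun l => (n * l == k)%N%:R)).
  apply: (L1_bounded (c := 1)) => [|w].
    exact: (measurable_fun_nat (fun l => (n * l == k)%N%:R)).
  by case: (_ == _); rewrite ?normr1 ?normr0.
have sb k : k%:R * mass P' Nc k = Emean P' (fun w => (Nc w)%:R) * mass P' Ns k.
  rewrite NcN -ENc; apply: size_biased_mass => //; exact: lt0r_neq0.
pose Yn := random_sum X N.
pose Yc := random_sum Xc Nc.
have mYn : measurable_fun setT Yn.
  exact: (measurable_at (h := fun n => partial_sum X (iota 0 n))).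
have mYc : measurable_fun setT Yc.
  exact: (measurable_at (h := fun n => partial_sum Xc (iota 0 n))).
have YYc : mass P' Yc =1 mass P Yn.
  by move=> k; apply/esym; exact: (mass_random_sum mN mNc mV mVc NNc VcV).
have lam0 : 0 < EN * EX by exact: mulr_gt0.
have [mass_gt0 massS] := poisson_mass_recurrence mZ lam0 Z_law.
have massXc' j : mass P' (Xc j) =1 mass P' (X' 0%N).
  by move=> k; rewrite XcX0 X'X0.
have massX'' j : mass P' (X' j) =1 mass P' (X' 0%N).
  by move=> k; rewrite !X'X0.
have EN0' := EN0; have EX0' := EX0; rewrite ENc in EN0'; rewrite EX' in EX0'.
have stein := random_sum_stein mNc mNs mXc mX' massX'' massXc' X'_indep iNc2
  iX'2 rho_ge0 rho_le1 EN0' EX0' mixture indNcVc indNsS sb.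
rewrite -ENc -ENc2 -EX' -EX'2 -EXd in stein.
apply: ge_ereal_sup => _ [h htest <-].
have h_lip i j : `|h i%:R - h j%:R| <= `|i%:R - j%:R :> R|.
  wlog ij : i j / (j <= i)%N => [H|].
    have [/H//|/ltnW/H] := leqP j i.
    by rewrite distrC (distrC i%:R).
  rewrite [leRHS]ger0_norm ?subr_ge0 ?ler_nat//.
  by apply: wasserstein_lipschitz => //; rewrite ler_nat.
have h_lip1 i j : `|h i%:R - h j%:R| <= 1 * `|i%:R - j%:R :> R| by rewrite mul1r.
pose hn k := h k%:R.
have [f [fE fstep]] := poisson_stein mZ lam0 mass_gt0 massS (h := hn) h_lip.
have f_lip := lipschitz_of_step fstep.
have [C f_growth] := stein_growth (ltW lam0) fE f_lip h_lip.
have [ifY [iuY bound]] := stein f (2 / Num.sqrt (EN * EX)) C f_lip f_growth.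
have iYc : L1 P' (fun w => (Yc w)%:R).
  exact: (L1_random_sum mNc mXc mX' massXc' iNc2 iX'2 indNcVc).
have ihYc : L1 P' (fun w => hn (Yc w)) by exact: (L1_lipschitz h_lip1).
have ihZ : L1 Q (fun w => hn (Z w)).
  exact: (L1_lipschitz_poisson mZ lam0 massS (h := hn) h_lip).
have ihYn := L1_mass_eq mYc mYn YYc ihYc.
have YE : h \o Y = fun w => hn (Yn w).
  by apply/funext => w; rewrite /hn /Yn /random_sum partial_sum_iota natr_sum.
have ZE : h \o (fun w => (Z w)%:R) = fun w => hn (Z w) by [].
rewrite YE ZE !expectation_L1// -(Emean_mass_eq mYc mYn YYc ihYc).
rewrite -EFinB abse_EFin lee_fin.
have -> : Emean P' (fun w => hn (Yc w)) - Emean Q (fun w => hn (Z w)) =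
    EN * EX * Emean P' (fun w => f (Yc w).+1) -
    Emean P' (fun w => (Yc w)%:R * f (Yc w)).
  rewrite -EmeanZ// -EmeanB//; last exact: L1Z.
  rewrite -[X in _ - X](Emean_cst P') -EmeanB//; last exact: L1_cst.
  by congr Emean; apply/funext => w; rewrite fE.
apply: (le_trans bound).
have D3E : Emean P' (fun w => `|\sum_(k < Nc w) (Xc k w)%:R -
      \sum_(j < (Ns w).-1) (X' j w)%:R|) =
    Emean P' (fun w => `|(random_sum Xc Nc w)%:R -
      (random_sum X' (fun w => (Ns w).-1) w)%:R|).
  by congr Emean; apply/funext => w; rewrite /random_sum !partial_sum_iota !natr_sum.
rewrite D3E; move: bound.
set s := Num.sqrt (EN * EX); set B1 := Emean P' _ + _ + _.
set B2 := EX2 / EX - 1 + _ => bound.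
have s0 : 0 < s by rewrite sqrtr_gt0.
have sE : 2 / s * (EN * EX) = 2 * s.
  rewrite -[EN * EX](@sqr_sqrtr _ (EN * EX)) ?ltW// -/s; field; exact: lt0r_neq0.
rewrite sE in bound *.
(* The bound itself forces the bracket to be nonnegative, so that the factor 2 may
   be enlarged to 3. *)
have : 0 <= 2 * s * (rho * B1 + (1 - rho) * B2) by apply: le_trans bound.
have s20 : 0 < 2 * s by rewrite mulr_gt0.
rewrite pmulr_rge0// => B0.
have -> : 3 * rho * s * B1 + 3 * (1 - rho) * s * B2 =
  3 * s * (rho * B1 + (1 - rho) * B2) by ring.
by rewrite ler_wpM2r// ler_wpM2r ?(ltW s0)// ler_nat.
Qed.
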